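(* Let $B_k\in\mathbb{R}^{r'\times r}$ be the randomized ALS matrix and $B_k^{ALS}\in\mathbb{R}^{r\times r}$ the standard ALS matrix described in the context, with $r'>r$ and $B_k^{ALS}$ nonsingular. Then for every $t\ge0$, with probability at least $1-2\exp(-ct^2)$, $$\kappa(B_k)\le\frac{1+C\sqrt{r/r'}+t/\sqrt{r'}}{1-C\sqrt{r/r'}-t/\sqrt{r'}}\;\kappa\!\left((B_k^{ALS})^{1/2}\right),$$ where $C=C_K$ and $c=c_K>0$ depend only on the sub-Gaussian norm $K=\max_i\|B_k(i,:)\|_{\psi_2}$ of the rows of $B_k$ and on the norm $\|(B_k^{ALS})^{-1/2}\|$.
   Context: Setting (ALS stands for alternating least squares): $d\ge2$, $k\in\{1,\dots,d\}$; for each $i\in\{1,\dots,d\}$, $i\neq k$, there are fixed vectors $\mathbf{F}_i^{1},\dots,\mathbf{F}_i^{r}\in\mathbb{R}^{M_i}$ and a random matrix $R_i\in\mathbb{R}^{M_i\times r'}$ with columns $\mathbf{R}_i^{1},\dots,\mathbf{R}_i^{r'}$. All entries of all the $R_i$ are mutually independent, and they are either signed Bernoulli random variables ($\pm1$ with probability $1/2$ each) or standard Gaussian random variables. Randomized ALS matrix: $B_k\in\mathbb{R}^{r'\times r}$ with $B_k(\hat l,\tilde l)=\prod_{i\ne k}\langle\mathbf{F}_i^{\tilde l},\mathbf{R}_i^{\hat l}\rangle$. Standard ALS matrix: $B_k^{ALS}\in\mathbb{R}^{r\times r}$ with $B_k^{ALS}(\hat l,\tilde l)=\prod_{i\ne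 k}\langle\mathbf{F}_i^{\tilde l},\mathbf{F}_i^{\hat l}\rangle$. It is symmetric positive semidefinite and equals the second moment matrix of each row of $B_k$; $(B_k^{ALS})^{1/2}$ is its positive semidefinite square root. $\|\cdot\|$ is the spectral norm, and $\kappa(B)=\sigma_{\max}(B)/\sigma_{\min}(B)$, where $\sigma_{\max}$ and $\sigma_{\min}$ denote the maximal and minimal (non-zero) singular values. Sub-Gaussian norm: for a real random variable $X$, $\|X\|_{\psi_2}=\sup_{p\ge1}p^{-1/2}(\mathbb{E}|X|^p)^{1/p}$; for a random vector $X\in\mathbb{R}^n$, $\|X\|_{\psi_2}=\sup_{\|\mathbf{x}\|_2=1}\|\langle X,\mathbf{x}\rangle\|_{\psi_2}$.
   Formalization: The formal theorem assumes that the denominator 1−C√(r/r')−t/√r' is positive (otherwise the bound is negative or undefined and fails for large t) and that the sub-Gaussian norm K is finite (it is infinite for Gaussian entries with d≥3). *)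

(* Defs.v *)
From HB Require Import structures.
From mathcomp Require Import all_boot all_order all_algebra.
From mathcomp Require Import all_classical all_reals all_analysis.

Set Implicit Arguments.
Unset Strict Implicit.
Unset Printing Implicit Defensive.

Import Order.TTheory GRing.Theory Num.Theory.
Import numFieldNormedType.Exports.

Local Open Scope classical_set_scope.
Local Open Scope ring_scope.

Definition dot (R : realType) (n : nat) (u v : 'cV[R]_n) : R :=
  (u^T *m v) 0 0.

Definition enorm (R : realType) (n : nat) (u : 'cV[R]_n) : R :=
  Num.sqrt (dot u u).

Definition spectral_norm (R : realType) (m n : nat) (A : 'M[R]_(m, n)) : R :=
  sup [set enorm (A *m x) | x in [set x : 'cV[R]_n | enorm x = 1]].

Definition singular_value (R : realType) (m n : nat) (A : 'M[R]_(m, n))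
    (s : R) : Prop :=
  0 <= s /\ eigenvalue (A^T *m A) (s ^+ 2).

(* The sets below are finite, so sup and inf are a maximum and a minimum
   whenever the sets are nonempty. *)
Definition sigma_max (R : realType) (m n : nat) (A : 'M[R]_(m, n)) : R :=
  sup [set s | singular_value A s].

Definition sigma_min (R : realType) (m n : nat) (A : 'M[R]_(m, n)) : R :=
  inf [set s | singular_value A s /\ s != 0].

(* The zero matrix has no nonzero singular value; its condition number is set
   to +oo, so that it never satisfies a finite upper bound. *)
Definition kappa (R : realType) (m n : nat) (A : 'M[R]_(m, n)) : \bar R :=
  if A == 0 then +oo%E else (sigma_max A / sigma_min A)%:E.

Definition psd (R : realType) (n : nat) (A : 'M[R]_n) : Prop :=
  A^T = A /\ forall x : 'cV[R]_n, 0 <= dot x (A *m x).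

(* Every positive semidefinite A has exactly one such S. *)
Definition is_psd_sqrt (R : realType) (n : nat) (S A : 'M[R]_n) : Prop :=
  psd S /\ S *m S = A.

Section Probability.
Context {disp : measure_display} {Omega : measurableType disp} {R : realType}.
Variable P : probability Omega R.

Definition psi2_norm (X : Omega -> R) : \bar R :=
  ereal_sup [set ((p `^ (- 2^-1))%:E * Lnorm P p%:E (EFin \o X))%E
            | p in [set p : R | 1 <= p]].

Definition psi2_norm_vec (n : nat) (X : Omega -> 'cV[R]_n) : \bar R :=
  ereal_sup [set psi2_norm (fun w => dot (X w) x)
            | x in [set x : 'cV[R]_n | enorm x = 1]].

(* Mutual independence of the subfamily (X_i) with i in D. *)
Definition mutually_independent (I : finType) (D : pred I)
    (X : I -> {RV P >-> R}) : Prop :=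
  forall (J : {set I}) (A : I -> set R),
    (forall i, i \in J -> D i) ->
    (forall i, i \in J -> measurable (A i)) ->
    P [set w | forall i, i \in J -> A i (X i w)] =
      (\prod_(i in J) P (X i @^-1` A i))%E.

Definition signed_bernoulli (X : {RV P >-> R}) : Prop :=
  P (X @^-1` [set 1]) = (2^-1)%:E /\ P (X @^-1` [set -1]) = (2^-1)%:E.

Definition standard_gaussian (X : {RV P >-> R}) : Prop :=
  forall A : set R, measurable A -> distribution P X A = normal_prob 0 1 A.

(* "E holds with probability at least p".  Going through a measurable subset
   makes the statement meaningful for arbitrary E; for a measurable E it is
   p <= P E. *)
Definition prob_at_least (p : R) (E : set Omega) : Prop :=
  exists A : set Omega, [/\ measurable A, A `<=` E & (p%:E <= P A)%E].

End Probability.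

(* In both matrices the factors with index k are never used. *)
Definition ALS_matrix (R : realType) (d : nat) (k : 'I_d) (r : nat)
    (M : 'I_d -> nat) (F : forall i, 'M[R]_(M i, r)) : 'M[R]_r :=
  \matrix_(lh, lt) \prod_(i | i != k) dot (col lt (F i)) (col lh (F i)).

Definition randomized_ALS_matrix (R : realType) (d : nat) (k : 'I_d)
    (r r' : nat) (M : 'I_d -> nat)
    (F : forall i, 'M[R]_(M i, r)) (G : forall i, 'M[R]_(M i, r')) :
    'M[R]_(r', r) :=
  \matrix_(lh, lt) \prod_(i | i != k) dot (col lt (F i)) (col lh (G i)).

(* Main.v *)
Require Import Defs.
From HB Require Import structures.
From mathcomp Require Import all_boot all_order all_algebra.
From mathcomp Require Import all_classical all_reals all_analysis.
From mathcomp Require Import measurable_realfun ring lra.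
Set Implicit Arguments.
Unset Strict Implicit.
Unset Printing Implicit Defensive.
Import Order.TTheory GRing.Theory Num.Theory.
Import numFieldNormedType.Exports.
Local Open Scope classical_set_scope.
Local Open Scope ring_scope.

(** Let [S] be the square root of the second moment matrix of the rows of [B].
    The rows of [B S^-1] are independent, isotropic and sub-Gaussian, and
    [kappa (B)] is at most [kappa (S)] times the ratio of the extreme factors by
    which [B S^-1] stretches a vector ([kappa_sandwich]). So it suffices that
    the quadratic form [|B S^-1 x|^2 - r' |x|^2] is at most [r' delta] on the
    unit sphere, where [delta = C sqrt (r / r') + t / sqrt r'].

    For a fixed [y] the form is a sum of independent centred variables, one per
    row. The moment growth in the sub-Gaussian norm makes the exponential
    moments of the squared row products quadratic near 0 ([sqr_mgf_bound]), and
    Chernoff's method bounds the tail ([chernoff_sqr_sum]). A net of at most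
    [64^r] lattice points, one of them within [1/4] of each unit vector, carries
    the bound over to the whole sphere ([net_form_bound], [card_grid_net]).

    Two ingredients come from the product structure of [B]. The entries of the
    random matrices are independent, hence so are functions of disjoint blocks
    of entries, by the pi-lambda theorem and Fubini ([sigma_independent],
    [expectation_prod]). With blocks labelled by rows this factors the
    exponential moments; within a row, with blocks labelled by [i], and with
    [E X = 0] and [E X^2 = 1] for each entry ([entry_moments]), it gives the
    second moments of a row ([row_second_moment]). *)

(** * Quadratic forms, singular values and the condition number *)

Section LinearAlgebra.
Context {R : realType}.
Implicit Types m n : nat.

Lemma dotE n (u v : 'cV[R]_n) : dot u v = \sum_i u i 0 * v i 0.
Proof. by rewrite /dot mxE; apply: eq_bigr => i _; rewrite mxE. Qed.

Lemma dotC n (u v : 'cV[R]_n) : dot u v = dot v u.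
Proof. by rewrite !dotE; apply: eq_bigr => i _; rewrite mulrC. Qed.

Lemma dotDl n (u v w : 'cV[R]_n) : dot (u + v) w = dot u w + dot v w.
Proof. by rewrite /dot linearD mulmxDl mxE. Qed.

Lemma dotDr n (u v w : 'cV[R]_n) : dot w (u + v) = dot w u + dot w v.
Proof. by rewrite /dot mulmxDr mxE. Qed.

Lemma dotZl n a (u v : 'cV[R]_n) : dot (a *: u) v = a * dot u v.
Proof. by rewrite /dot linearZ -scalemxAl mxE. Qed.

Lemma dotZr n a (u v : 'cV[R]_n) : dot u (a *: v) = a * dot u v.
Proof. by rewrite /dot -scalemxAr mxE. Qed.

Lemma dotBl n (u v w : 'cV[R]_n) : dot (u - v) w = dot u w - dot v w.
Proof. by rewrite dotDl -scaleN1r dotZl mulN1r. Qed.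

Lemma dotBr n (u v w : 'cV[R]_n) : dot w (u - v) = dot w u - dot w v.
Proof. by rewrite dotDr -scaleN1r dotZr mulN1r. Qed.

Lemma dot0l n (u : 'cV[R]_n) : dot 0 u = 0.
Proof. by rewrite -(scale0r u) dotZl mul0r. Qed.

Lemma dot_ge0 n (u : 'cV[R]_n) : 0 <= dot u u.
Proof. by rewrite dotE sumr_ge0 // => i _; rewrite -expr2 sqr_ge0. Qed.

Lemma dot_eq0 n (u : 'cV[R]_n) : (dot u u == 0) = (u == 0).
Proof.
apply/idP/eqP => [|->]; last by rewrite dot0l.
rewrite dotE psumr_eq0; last by move=> i _; rewrite -expr2 sqr_ge0.
move=> /allP h; apply/matrixP => i j; rewrite ord1 mxE.
by have := h i (mem_index_enum i); rewrite -expr2 sqrf_eq0 => /eqP.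
Qed.

Lemma dot_gt0 n (u : 'cV[R]_n) : (0 < dot u u) = (u != 0).
Proof. by rewrite lt0r dot_ge0 andbT dot_eq0. Qed.

Lemma dot_mulmx m n (A : 'M[R]_(m, n)) u v :
  dot (A *m u) v = dot u (A^T *m v).
Proof. by rewrite /dot trmx_mul mulmxA. Qed.

Lemma dot_mulmx_rows m n (A : 'M[R]_(m, n)) v :
  dot (A *m v) (A *m v) = \sum_l dot (row l A)^T v ^+ 2.
Proof.
rewrite dotE; apply: eq_bigr => l _; rewrite -expr2; congr (_ ^+ 2).
by rewrite mxE dotE; apply: eq_bigr => j _; rewrite !mxE.
Qed.

Lemma enorm_ge0 n (u : 'cV[R]_n) : 0 <= enorm u.
Proof. exact: sqrtr_ge0. Qed.

Lemma sqr_enorm n (u : 'cV[R]_n) : enorm u ^+ 2 = dot u u.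
Proof. by rewrite sqr_sqrtr // dot_ge0. Qed.

Lemma enormZ n a (u : 'cV[R]_n) : enorm (a *: u) = `|a| * enorm u.
Proof.
by rewrite /enorm dotZl dotZr mulrA -expr2 sqrtrM ?sqr_ge0 // sqrtr_sqr.
Qed.

Lemma enorm_gt0 n (u : 'cV[R]_n) : (0 < enorm u) = (u != 0).
Proof. by rewrite sqrtr_gt0 dot_gt0. Qed.

(** Cauchy-Schwarz for a semidefinite form: the value of the form at
    [b x - a y], with [a] and [b] read off the claim, is nonnegative. *)
Lemma psd_cauchy_schwarz n (A : 'M[R]_n) (x y : 'cV[R]_n) : psd A ->
  dot x (A *m y) ^+ 2 <= dot x (A *m x) * dot y (A *m y).
Proof.
move=> [sA pA].
have sym : dot y (A *m x) = dot x (A *m y) by rewrite dotC dot_mulmx sA.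
set a := dot x (A *m x); set b := dot x (A *m y); set c := dot y (A *m y).
have H s t : 0 <= s ^+ 2 * a + 2 * s * t * b + t ^+ 2 * c.
  have := pA (s *: x + t *: y).
  rewrite mulmxDr -!scalemxAr !(dotDl, dotDr, dotZl, dotZr) sym -/a -/b -/c.
  by congr (_ <= _); ring.
have a0 : 0 <= a by exact: pA.
have [a00|an0] := eqVneq a 0.
  have [b0|bn0] := eqVneq b 0; first by rewrite b0 a00 mul0r expr0n.
  (* the form vanishes at [x], so it is affine along [x] and must be constant *)
  have := H (- (c + 1) / (2 * b)) 1.
  rewrite a00 (_ : _ + _ = - 1); last by field.
  by rewrite ler0N1.
have ap : 0 < a by rewrite lt0r an0.
have := H (- b) a.
rewrite (_ : _ + _ = a * (a * c - b ^+ 2)); last by ring.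
by rewrite pmulr_rge0 // subr_ge0.
Qed.

Lemma quadratic_form_bounded n (A : 'M[R]_n) :
  exists2 c, 0 < c & forall x : 'cV[R]_n, `|dot x (A *m x)| <= c * dot x x.
Proof.
have ge0 : 0 <= \sum_i \sum_j `|A i j|.
  by apply: sumr_ge0 => i _; apply: sumr_ge0.
exists (1 + \sum_i \sum_j `|A i j|); first by rewrite ltr_wpDr.
move=> x; rewrite mulrDl mul1r.
apply: (@le_trans _ _ (0 + (\sum_i \sum_j `|A i j|) * dot x x)); last first.
  by rewrite lerD2r dot_ge0.
rewrite add0r dotE (le_trans (ler_norm_sum _ _ _))// mulr_suml ler_sum // => i _.
rewrite mxE mulr_sumr (le_trans (ler_norm_sum _ _ _))// mulr_suml ler_sum // => j _.
rewrite mulrCA normrM ler_wpM2l //.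
have le k : x k 0 ^+ 2 <= dot x x.
  rewrite dotE (bigD1 k) //= -expr2 lerDl sumr_ge0 // => l _.
  by rewrite -expr2 sqr_ge0.
have := le i; have := le j; rewrite normrM.
have := sqr_ge0 (`|x i 0| - `|x j 0|).
rewrite -[x i 0 ^+ 2]real_normK ?num_real // -[x j 0 ^+ 2]real_normK ?num_real //.
by move=> *; nra.
Qed.

(** With [y = A x], Cauchy-Schwarz for the form [A] gives
    [|y|^4 <= <x, A x> <y, A y>], so [|y|^2] is at most a multiple of
    [<x, A x>]; and [x] is recovered from [y] by the bounded map [invmx A]. *)
Lemma psd_unit_coercive n (A : 'M[R]_n) : psd A -> A \in unitmx ->
  exists2 e, 0 < e & forall x : 'cV[R]_n, e * dot x x <= dot x (A *m x).
Proof.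
move=> pA uA; have [sA A0] := pA.
have [c c0 Hc] := quadratic_form_bounded A.
have [c' c'0 Hc'] := quadratic_form_bounded ((invmx A)^T *m invmx A).
have cc : 0 < c * c' by rewrite mulr_gt0.
exists ((c * c')^-1); first by rewrite invr_gt0.
move=> x; rewrite ler_pdivrMl //.
set y := A *m x.
have xy : x = invmx A *m y by rewrite /y mulKmx.
have h1 : dot x x <= c' * dot y y.
  rewrite {1 2}xy dot_mulmx mulmxA.
  exact: le_trans (ler_norm _) (Hc' y).
have h2 : dot y y <= c * dot x y.
  have := psd_cauchy_schwarz x y pA.
  have -> : dot x (A *m y) = dot y y by rewrite -[in LHS]sA -dot_mulmx.
  have := le_trans (ler_norm _) (Hc y) => hy hxy.
  have [y0|yn0] := eqVneq y 0; first by rewrite y0 dot0l dotC dot0l mulr0.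
  have yp : 0 < dot y y by rewrite dot_gt0.
  rewrite -(ler_pM2r yp) -expr2 (le_trans hxy)//.
  by rewrite -/y (mulrC c) -mulrA ler_wpM2l // A0.
by rewrite (le_trans h1)// (mulrC c) -mulrA ler_pM2l.
Qed.

Lemma dot_scalar_mx n a (x : 'cV[R]_n) : dot x (a%:M *m x) = a * dot x x.
Proof. by rewrite mul_scalar_mx dotZr. Qed.

Lemma psd_sub_scalar n a (A : 'M[R]_n) : A^T = A ->
  (forall x : 'cV[R]_n, a * dot x x <= dot x (A *m x)) -> psd (A - a%:M).
Proof.
move=> sA H; split; first by rewrite linearB /= tr_scalar_mx sA.
by move=> x; rewrite mulmxBl dotBr dot_scalar_mx subr_ge0.
Qed.

Lemma eigenvalue_nonunit n a (A : 'M[R]_n) :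
  A - a%:M \notin unitmx -> eigenvalue A a.
Proof.
by rewrite -row_free_unit -kermx_eq0 /eigenvalue /eigenspace.
Qed.

Lemma col_neq0 n : (0 < n)%N -> exists v : 'cV[R]_n, v != 0.
Proof.
case: n => // n _; exists (const_mx 1).
by apply/eqP => /matrixP /(_ 0 0); rewrite !mxE => /eqP; rewrite oner_eq0.
Qed.

(** The infimum of the Rayleigh quotient is an eigenvalue: the form shifted by
    it is semidefinite but not coercive, hence singular. *)
Lemma rayleigh_min n (A : 'M[R]_n) : (0 < n)%N -> A^T = A ->
  exists2 a, eigenvalue A a & forall x : 'cV[R]_n, a * dot x x <= dot x (A *m x).
Proof.
move=> /col_neq0 [v v0] sA.
have [c c0 Hc] := quadratic_form_bounded A.
pose E := [set a | forall x : 'cV[R]_n, a * dot x x <= dot x (A *m x)].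
have supE : has_sup E.
  split.
    exists (- c) => x; rewrite mulNr lerNl (le_trans _ (Hc x)) //.
    by rewrite -normrN ler_norm.
  exists c => a Ea; have vp : 0 < dot v v by rewrite dot_gt0.
  rewrite -(ler_pM2r vp); apply: le_trans (Ea v) _.
  exact: le_trans (ler_norm _) (Hc v).
have Esup : E (sup E).
  move=> x; have [->|x0] := eqVneq x 0; first by rewrite !dot0l mulr0.
  have xp : 0 < dot x x by rewrite dot_gt0.
  rewrite -ler_pdivlMr //; apply: ge_sup; first by case: supE.
  by move=> a Ea; rewrite ler_pdivlMr.
exists (sup E) => //; apply: eigenvalue_nonunit; apply/negP => u.
have [e e0 He] := psd_unit_coercive (psd_sub_scalar sA Esup) u.
have : E (sup E + e).
  move=> x; have := He x; rewrite mulmxBl dotBr dot_scalar_mx mulrDl.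
  by rewrite lerBrDl.
move=> /(ub_le_sup supE.2); rewrite gerDl leNgt e0 //.
Qed.

Lemma eigenvalueN n (A : 'M[R]_n) a : eigenvalue (- A) (- a) -> eigenvalue A a.
Proof.
move=> /eigenvalueP [v vA v0]; apply/eigenvalueP; exists v => //.
by apply: oppr_inj; rewrite -mulmxN vA scaleNr.
Qed.

Lemma rayleigh_max n (A : 'M[R]_n) : (0 < n)%N -> A^T = A ->
  exists2 a, eigenvalue A a & forall x : 'cV[R]_n, dot x (A *m x) <= a * dot x x.
Proof.
move=> n0 sA.
have sN : (- A)^T = - A by rewrite linearN /= sA.
have [a ea Ha] := rayleigh_min n0 sN.
exists (- a); first by apply: eigenvalueN; rewrite opprK.
move=> x; have := Ha x; rewrite mulNmx -scaleN1r dotZr mulN1r mulNr.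
by rewrite lerNr.
Qed.

Lemma gram_sym m n (A : 'M[R]_(m, n)) : (A^T *m A)^T = A^T *m A.
Proof. by rewrite trmx_mul trmxK. Qed.

Lemma dot_gram m n (A : 'M[R]_(m, n)) x :
  dot x ((A^T *m A) *m x) = dot (A *m x) (A *m x).
Proof. by rewrite -mulmxA -dot_mulmx. Qed.

Lemma singular_valueP m n (A : 'M[R]_(m, n)) s : singular_value A s ->
  exists2 v : 'cV[R]_n, v != 0 & dot (A *m v) (A *m v) = s ^+ 2 * dot v v.
Proof.
move=> [s0 /eigenvalueP [v vA v0]]; exists v^T.
  by apply: contra v0 => /eqP e; rewrite -(trmxK v) e trmx0.
have e : (A^T *m A) *m v^T = s ^+ 2 *: v^T.
  by apply: trmx_inj; rewrite linearZ /= trmxK trmx_mul trmxK gram_sym.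
by rewrite -dot_gram e dotZr.
Qed.

Lemma singular_value_le m n (A : 'M[R]_(m, n)) q s : 0 <= q ->
  (forall x, dot (A *m x) (A *m x) <= q ^+ 2 * dot x x) ->
  singular_value A s -> s <= q.
Proof.
move=> q0 H svs; have [v v0 e] := singular_valueP svs.
have := H v; rewrite e ler_pM2r ?dot_gt0 // ler_pXn2r ?nnegrE //.
by case: svs.
Qed.

Lemma singular_value_ge m n (A : 'M[R]_(m, n)) p s : 0 <= p ->
  (forall x, p ^+ 2 * dot x x <= dot (A *m x) (A *m x)) ->
  singular_value A s -> p <= s.
Proof.
move=> p0 H svs; have [v v0 e] := singular_valueP svs.
have := H v; rewrite e ler_pM2r ?dot_gt0 // ler_pXn2r ?nnegrE //.
by case: svs.
Qed.

Lemma eigenvalue_gram_sqrt m n (A : 'M[R]_(m, n)) a : 0 <= a ->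
  eigenvalue (A^T *m A) a -> singular_value A (Num.sqrt a).
Proof. by move=> a0 ea; split; rewrite ?sqrtr_ge0 // sqr_sqrtr. Qed.

Lemma gram_eigenvalue_ge0 m n (A : 'M[R]_(m, n)) a :
  eigenvalue (A^T *m A) a -> 0 <= a.
Proof.
move=> /eigenvalueP [v vA v0].
have e : (A^T *m A) *m v^T = a *: v^T.
  by apply: trmx_inj; rewrite linearZ /= trmxK trmx_mul trmxK gram_sym.
have vp : 0 < dot v^T v^T.
  by rewrite dot_gt0; apply: contra v0 => /eqP e'; rewrite -(trmxK v) e' trmx0.
by have := dot_ge0 (A *m v^T); rewrite -dot_gram e dotZr pmulr_lge0.
Qed.

(** The largest value of the Rayleigh quotient of [A^T A] is an eigenvalue, so
    its root is a singular value, and it bounds all of them. *)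
Lemma sigma_maxP m n (A : 'M[R]_(m, n)) : (0 < n)%N ->
  0 <= sigma_max A /\
  forall x, dot (A *m x) (A *m x) <= sigma_max A ^+ 2 * dot x x.
Proof.
move=> n0; have [a ea Ha] := rayleigh_max n0 (gram_sym A).
have a0 := gram_eigenvalue_ge0 ea.
have sva := eigenvalue_gram_sqrt a0 ea.
have le : Num.sqrt a <= sigma_max A.
  apply: ub_le_sup => //; exists (Num.sqrt a) => s; apply: singular_value_le.
    exact: sqrtr_ge0.
  by move=> x; rewrite sqr_sqrtr // -dot_gram.
have s0 : 0 <= sigma_max A by apply: le_trans le; rewrite sqrtr_ge0.
split=> // x; rewrite -dot_gram (le_trans (Ha x)) // ler_wpM2r ?dot_ge0 //.
by rewrite -[leLHS]sqr_sqrtr // ler_pXn2r ?nnegrE ?sqrtr_ge0.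
Qed.

Lemma sigma_minP n (A : 'M[R]_n) : (0 < n)%N -> A \in unitmx ->
  0 < sigma_min A /\
  forall x, sigma_min A ^+ 2 * dot x x <= dot (A *m x) (A *m x).
Proof.
move=> n0 uA; have [a ea Ha] := rayleigh_min n0 (gram_sym A).
have a0 := gram_eigenvalue_ge0 ea.
have sva := eigenvalue_gram_sqrt a0 ea.
have an0 : 0 < a.
  rewrite lt0r a0 andbT; apply/eqP => a00.
  move: ea; rewrite a00 => /eigenvalueP [v vA v0].
  have u : A^T *m A \in unitmx by rewrite unitmx_mul unitmx_tr uA.
  by case/eqP: v0; rewrite -(mulmxK u v) vA scale0r mul0mx.
have sa0 : 0 < Num.sqrt a by rewrite sqrtr_gt0.
have le : sigma_min A <= Num.sqrt a.
  apply: ge_inf; last by split=> //; rewrite gt_eqF.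
  by exists 0 => s [] [].
have ge : Num.sqrt a <= sigma_min A.
  apply: lb_le_inf; first by exists (Num.sqrt a); split=> //; rewrite gt_eqF.
  move=> s [svs _]; apply: singular_value_ge svs; first exact: sqrtr_ge0.
  by move=> x; rewrite sqr_sqrtr // -dot_gram.
have -> : sigma_min A = Num.sqrt a by apply/eqP; rewrite eq_le le ge.
by split=> // x; rewrite sqr_sqrtr // -dot_gram.
Qed.

Lemma spectral_norm_bound m n (A : 'M[R]_(m, n)) x :
  dot (A *m x) (A *m x) <= spectral_norm A ^+ 2 * dot x x.
Proof.
have [->|x0] := eqVneq x 0; first by rewrite mulmx0 !dot0l mulr0.
have [c c0 Hc] := quadratic_form_bounded (A^T *m A).
have Au u : enorm u = 1 -> enorm (A *m u) <= spectral_norm A.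
  move=> u1; apply: ub_le_sup; last by exists u.
  exists (c + 1) => _ [v v1 <-].
  have v1' : dot v v = 1 by rewrite -sqr_enorm v1 expr1n.
  have := le_trans (ler_norm _) (Hc v); rewrite dot_gram v1' mulr1 -sqr_enorm.
  by have := enorm_ge0 (A *m v); nra.
have xp : 0 < enorm x by rewrite enorm_gt0.
have := Au ((enorm x)^-1 *: x).
rewrite -scalemxAr !enormZ ger0_norm ?invr_ge0 ?enorm_ge0 // mulVf ?gt_eqF // => /(_ erefl).
rewrite ler_pdivrMl // => h.
rewrite -!sqr_enorm -exprMn ler_pXn2r ?nnegrE ?enorm_ge0 1?mulrC //.
exact: le_trans (enorm_ge0 _) h.
Qed.

(** Each singular value of [B] lies between [p] times the smallest and [q]
    times the largest singular value of [S]. *)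
Lemma kappa_sandwich m n (B : 'M[R]_(m, n)) (S : 'M[R]_n) p q :
  (0 < n)%N -> S \in unitmx -> 0 < p -> 0 <= q ->
  (forall x, p ^+ 2 * dot (S *m x) (S *m x) <= dot (B *m x) (B *m x)
             <= q ^+ 2 * dot (S *m x) (S *m x)) ->
  (kappa B <= (q / p)%:E * kappa S)%E.
Proof.
move=> n0 uS p0 q0 H.
have [M0 HM] := sigma_maxP S n0.
have [m0 Hm] := sigma_minP n0 uS.
have [v v0] := col_neq0 n0.
have Sv0 : S *m v != 0.
  by apply: contraNneq v0 => e; rewrite -(mulKmx uS v) e mulmx0.
have Sn0 : S != 0 by apply: contraNneq Sv0 => ->; rewrite mul0mx.
have Bn0 : B != 0.
  apply/eqP => B0; have /andP[] := H v; rewrite B0 mul0mx dot0l leNgt.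
  by rewrite mulr_gt0 ?exprn_gt0 ?dot_gt0.
have Hq x : dot (B *m x) (B *m x) <= (q * sigma_max S) ^+ 2 * dot x x.
  have /andP[_ hx] := H x; rewrite (le_trans hx)// [(q * _) ^+ 2]exprMn -[leRHS]mulrA.
  by rewrite ler_wpM2l ?sqr_ge0.
have Hp x : (p * sigma_min S) ^+ 2 * dot x x <= dot (B *m x) (B *m x).
  have /andP[hx _] := H x; rewrite (le_trans _ hx)// [(p * _) ^+ 2]exprMn -[leLHS]mulrA.
  by rewrite ler_wpM2l ?sqr_ge0.
rewrite /kappa (negPf Sn0) (negPf Bn0) -EFinM lee_fin.
have pm0 : 0 < p * sigma_min S by rewrite mulr_gt0.
have qM0 : 0 <= q * sigma_max S by rewrite mulr_ge0.
have sB : sigma_max B <= q * sigma_max S.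
  (* The supremum of the empty set is 0. *)
  rewrite /sigma_max; have [->|/set0P ne] := eqVneq [set s | singular_value B s] set0.
    by rewrite sup0.
  by apply: ge_sup => // s; apply: singular_value_le.
have -> : q / p * (sigma_max S / sigma_min S) =
    q * sigma_max S / (p * sigma_min S).
  by rewrite invfM mulrACA.
(* The infimum of the empty set is 0, and so is the inverse of 0. *)
have [e|/set0P ne] := eqVneq [set s | singular_value B s /\ s != 0] set0.
  by rewrite /sigma_min e inf0 invr0 mulr0 divr_ge0 // ltW.
have sb : p * sigma_min S <= sigma_min B.
  apply: lb_le_inf => // s [svs _].
  by apply: singular_value_ge svs; first exact: ltW.
have sb0 : 0 < sigma_min B by apply: lt_le_trans sb.
apply: (@le_trans _ _ (q * sigma_max S / sigma_min B)).
  by rewrite ler_pM2r ?invr_gt0.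
by rewrite ler_wpM2l // lef_pV2 // posrE.
Qed.

End LinearAlgebra.

(** * A net of lattice points in the unit ball *)

Section Net.
Context {R : realType}.

Section Grid.
Variables (n : nat).
Let h : R := 4 * Num.sqrt n%:R.

(** The lattice of mesh [1 / (4 sqrt n)]; a coordinate is stored as a sign and
    an absolute value. *)
Definition grid (z : {ffun 'I_n -> bool * 'I_(4 * n).+1}) : 'cV[R]_n :=
  \col_i ((-1) ^+ (z i).1 * ((z i).2%:R / h)).

Definition grid_net : {set {ffun 'I_n -> bool * 'I_(4 * n).+1}} :=
  [set z : {ffun 'I_n -> bool * 'I_(4 * n).+1} |
    (\sum_i (z i).2 <= 4 * n)%N && (dot (grid z) (grid z) <= 1)]%SET.

Lemma sum_half_pow_le2 m : \sum_(j < m) (2^-1 : R) ^+ j <= 2.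
Proof.
suff -> : \sum_(j < m) (2^-1 : R) ^+ j = 2 - 2 * 2^-1 ^+ m.
  by rewrite gerBl mulr_ge0 // exprn_ge0 // invr_ge0.
elim: m => [|m IH]; first by rewrite big_ord0 expr0; ring.
by rewrite big_ord_recr /= IH exprS; field.
Qed.

(** Weigh each lattice point by [2^-(sum of absolute values)]: the total weight
    factors over the coordinates and is at most [4^n], while each counted point
    weighs at least [2^-(4n)]. *)
Lemma card_grid_net : (#|grid_net|%:R : R) <= 64 ^+ n.
Proof.
pose w (z : {ffun 'I_n -> bool * 'I_(4 * n).+1}) : R :=
  \prod_i 2^-1 ^+ (z i).2.
have half0 : (0 : R) <= 2^-1 by rewrite invr_ge0.
have w0 z : 0 <= w z by apply: prodr_ge0 => i _; rewrite exprn_ge0.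
have tot : \sum_z w z <= 4 ^+ n.
  rewrite /w -(bigA_distr_bigA (fun _ (p : bool * 'I_(4 * n).+1) => 2^-1 ^+ p.2)).
  rewrite prodr_const card_ord lerXn2r ?nnegrE //.
    by apply: sumr_ge0 => p _; rewrite exprn_ge0.
  rewrite -(pair_bigA _ (fun (_ : bool) (j : 'I_(4 * n).+1) => 2^-1 ^+ j)) /=.
  by rewrite big_bool /=; have := sum_half_pow_le2 (4 * n).+1; lra.
have low z : z \in grid_net -> 2^-1 ^+ (4 * n) <= w z.
  rewrite inE => /andP[hz _]; rewrite /w prodrXr.
  by rewrite ler_wiXn2l // invf_le1 // ler1n.
have : \sum_(z in grid_net) 2^-1 ^+ (4 * n) <= 4 ^+ n :> R.
  apply: le_trans tot; rewrite [leRHS](bigID (mem grid_net)) /=.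
  by apply: ler_wpDr; [exact: sumr_ge0|exact: ler_sum].
rewrite sumr_const -[leLHS]mulr_natl -ler_pdivlMr ?exprn_gt0 ?invr_gt0 // => /le_trans; apply.
by rewrite exprVn invrK exprM -exprMn (_ : 4 * 2 ^+ 4 = 64) //; ring.
Qed.

(** Round each coordinate toward 0, which stays in the unit ball and makes an
    error of at most the mesh. The absolute values add up to at most [4 n]
    because [4 sqrt n |x_i| <= 2 n x_i^2 + 2]. *)
Lemma grid_approx (x : 'cV[R]_n) : dot x x = 1 ->
  exists2 z, z \in grid_net & dot (x - grid z) (x - grid z) <= 16^-1.
Proof.
move=> x1.
have n0 : (0 < n)%N.
  case: (posnP n) => // n0; move: x1; rewrite dotE big1 => [/esym/eqP|[i i_lt] _].
    by rewrite oner_eq0.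
  by exfalso; rewrite n0 in i_lt.
have sn0 : 0 < Num.sqrt n%:R :> R by rewrite sqrtr_gt0 ltr0n.
have sn2 : Num.sqrt n%:R ^+ 2 = n%:R :> R by rewrite sqr_sqrtr.
have h0 : 0 < h by rewrite mulr_gt0.
have h2 : h ^+ 2 = 16 * n%:R by rewrite exprMn sn2; congr (_ * _); ring.
pose k i := Num.truncn (`|x i 0| * h).
have kP i : (k i)%:R <= `|x i 0| * h < (k i).+1%:R.
  by rewrite truncn_itv // mulr_ge0 // ltW.
have ksum : (\sum_i k i <= 4 * n)%N.
  rewrite -(ler_nat R) natr_sum.
  apply: (@le_trans _ _ (\sum_i (2 * n%:R * x i 0 ^+ 2 + 2))).
    apply: ler_sum => i _; have /andP[ki _] := kP i; apply: le_trans ki _.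
    have := sqr_ge0 (Num.sqrt n%:R * `|x i 0| - 1).
    by move=> ?; rewrite -[in leRHS]sn2 -[x i 0 ^+ 2]real_normK ?num_real // /h; lra.
  rewrite big_split /= -mulr_sumr sumr_const card_ord.
  under eq_bigr do rewrite expr2.
  by rewrite -dotE x1 mulr1 natrM -mulr_natr; lra.
have kle i : (k i < (4 * n).+1)%N.
  by rewrite ltnS (leq_trans _ ksum) // (bigD1 i) //= leq_addr.
pose z : {ffun 'I_n -> bool * 'I_(4 * n).+1} :=
  [ffun i => (x i 0 < 0, Ordinal (kle i))].
have zE i : grid z i 0 = (-1) ^+ (x i 0 < 0)%R * ((k i)%:R / h).
  by rewrite mxE ffunE.
have kh i : (k i)%:R / h <= `|x i 0| < (k i)%:R / h + h^-1.
  have /andP[k1 k2] := kP i.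
  by rewrite ler_pdivrMr // k1 -[X in _ + X]mul1r -mulrDl natr1 ltr_pdivlMr.
exists z.
  rewrite inE; apply/andP; split; first by under eq_bigr do rewrite ffunE /=.
  rewrite -x1 !dotE; apply: ler_sum => i _; rewrite zE mulrACA -expr2 sqrr_sign mul1r.
  have /andP[k1 _] := kh i.
  rewrite -[x i 0 * _]expr2 -[x i 0 ^+ 2]real_normK ?num_real // -expr2.
  by rewrite ler_pXn2r ?nnegrE // divr_ge0 // ltW.
apply: (@le_trans _ _ (\sum_(i < n) (h^-1) ^+ 2)).
  rewrite dotE; apply: ler_sum => i _; rewrite !mxE -/(k i) ffunE /= -expr2.
  rewrite [X in X - _](realEsign (num_real (x i 0))).
  have [k1 k2] := andP (kh i).
  rewrite -mulrBr exprMn sqrr_sign mul1r ler_pXn2r ?nnegrE ?invr_ge0 ?subr_ge0 //; last exact: ltW.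
  by rewrite lerBlDl ltW.
rewrite sumr_const card_ord exprVn h2 invfM -[(_ * _) *+ n]mulr_natr -[leLHS]mulrA mulVf ?mulr1 //.
by rewrite pnatr_eq0 -lt0n.
Qed.

End Grid.

(** If [c] bounds the form on unit vectors, so does [e + c / 2]: replace [u] by
    a nearby net point [y] and polarize the error [<u - y, Q (u + y)>]. *)
Lemma net_form_step n (Q : 'M[R]_n) (e c : R) : Q^T = Q ->
  (forall z, z \in grid_net n -> `|dot (grid z) (Q *m grid z)| <= e) ->
  (forall x, `|dot x (Q *m x)| <= c * dot x x) ->
  forall u, dot u u = 1 -> `|dot u (Q *m u)| <= e + c / 2.
Proof.
move=> sQ He Hc u u1; have [z zN uy] := grid_approx u1.
have y1 : dot (grid z) (grid z) <= 1 by move: zN; rewrite inE => /andP[].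
set y := grid z in y1 uy.
have Hy : `|dot y (Q *m y)| <= e by exact: He.
have sym a b : dot a (Q *m b) = dot b (Q *m a) by rewrite dotC dot_mulmx sQ.
pose a : 'cV[R]_n := u - y; pose b : 'cV[R]_n := u + y.
have ab : dot a a = 1 + dot y y - 2 * dot u y.
  by rewrite /a !(dotBl, dotBr) u1 (dotC y u); ring.
have bb : dot b b = 1 + dot y y + 2 * dot u y.
  by rewrite /b !(dotDl, dotDr) u1 (dotC y u); ring.
have uE : dot u (Q *m u) = dot y (Q *m y) + dot a (Q *m b).
  rewrite /a /b mulmxDr !(dotBl, dotDr) (sym y u); ring.
rewrite -/a in uy; clearbody a b.
have c0 : 0 <= c by have := Hc u; rewrite u1 mulr1; apply: le_trans.
(* The difference of the form at these two vectors is [4 <a, Q b>]. The weights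
   balance [|a|^2 <= 1/16] and [|b|^2 <= 4 - |a|^2]: the squared lengths add up
   to at most 2. *)
have := Hc (3 *: a + 3^-1 *: b); have := Hc (3 *: a - 3^-1 *: b).
rewrite !(mulmxDr, mulmxN, mulmxBr) -!scalemxAr.
rewrite !(dotBl, dotBr, dotDl, dotDr, dotZl, dotZr) (sym b a) (dotC b a).
have cT : c * (18 * dot a a + 2 / 9 * dot b b) <= c * 2.
  by apply: ler_wpM2l => //; lra.
move: Hy; rewrite uE !ler_norml => /andP[? ?] /andP[? ?] /andP[? ?].
apply/andP; split; lra.
Qed.

(** The least bound [q] of the form on the unit sphere satisfies
    [q <= e + q / 2]. *)
Lemma net_form_bound n (Q : 'M[R]_n) (e : R) : (0 < n)%N -> Q^T = Q ->
  (forall z, z \in grid_net n -> `|dot (grid z) (Q *m grid z)| <= e) ->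
  forall x, `|dot x (Q *m x)| <= 2 * e * dot x x.
Proof.
move=> n0 sQ He; have [v v0] := col_neq0 n0 (R := R).
pose E := [set c | forall x, `|dot x (Q *m x)| <= c * dot x x].
have homog c : (forall u, dot u u = 1 -> `|dot u (Q *m u)| <= c) -> E c.
  move=> H x; have [->|x0] := eqVneq x 0; first by rewrite !dot0l normr0 mulr0.
  have xp : 0 < enorm x by rewrite enorm_gt0.
  pose a := (enorm x)^-1.
  have a2 : a ^+ 2 * dot x x = 1.
    by rewrite -sqr_enorm -exprMn mulVf ?gt_eqF // expr1n.
  have := H (a *: x); rewrite -scalemxAr dotZl dotZr mulrA -expr2 a2.
  rewrite dotZl dotZr mulrA -expr2 normrM ger0_norm ?sqr_ge0 // => /(_ erefl) h.
  by rewrite -(@ler_pM2l _ (a ^+ 2)) ?exprn_gt0 ?invr_gt0 // mulrCA a2 mulr1.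
have [c0 c0p Hc0] := quadratic_form_bounded Q.
have lbE : has_inf E.
  split; first by exists c0.
  exists 0 => c Ec; have := Ec v.
  by move=> /(le_trans (normr_ge0 _)); rewrite pmulr_lge0 // dot_gt0.
have Einf : E (inf E).
  apply: homog => u u1; apply: lb_le_inf; first by exists c0.
  by move=> c /(_ u); rewrite u1 mulr1.
have : inf E <= e + inf E / 2.
  by apply: ge_inf; [case: lbE|apply/homog/net_form_step].
move=> h x; apply: le_trans (Einf x) _.
by rewrite ler_wpM2r ?dot_ge0 //; lra.
Qed.

End Net.

(** * Independence of blocks of variables *)

Section Independence.
Context {disp : measure_display} {Omega : measurableType disp} {R : realType}.
Variable P : probability Omega R.

(** The events independent of [C] form a lambda-system. *)
Lemma dynkin_independent (G : set (set Omega)) (C : set Omega) :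
  setI_closed G -> G `<=` measurable -> measurable C ->
  (forall A, G A -> P (A `&` C) = (P A * P C)%E) ->
  forall A, <<s G >> A -> measurable A /\ P (A `&` C) = (P A * P C)%E.
Proof.
move=> GI Gm mC GC.
pose H := [set A | measurable A /\ P (A `&` C) = (P A * P C)%E].
have fC : P C \is a fin_num by exact: fin_num_measure.
suff : <<s G >> `<=` H by [].
apply: lambda_system_subset => //; last first.
  by move=> A GA; split; [exact: Gm|exact: GC].
apply/dynkin_lambda_system; split.
- by split=> //; rewrite setTI probability_setT mul1e.
- move=> A [mA PA]; split; first exact: measurableC.
  have fA : P A \is a fin_num by exact: fin_num_measure.
  rewrite probability_setC // muleBl ?fin_num_adde_defr // mul1e -PA.
  rewrite setIC -setDE measureD //; last by rewrite ltey_eq fC.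
  by rewrite setIC.
- move=> F tF HF; split; first by apply: bigcup_measurable => k _; case: (HF k).
  have mF k : measurable (F k) by case: (HF k).
  rewrite setI_bigcupl !measure_bigcup //=; last 2 first.
  + by move=> k _; exact: measurableI.
  + exact: trivIset_setIr.
  rewrite muleC -(fineK fC) -nneseriesZl //.
  by apply: eq_eseriesr => k _; rewrite (fineK fC) muleC; case: (HF k).
Qed.

Section Family.
Context {I : finType} (D : pred I) (X : I -> {RV P >-> R}).

(** Events prescribing finitely many of the variables with index in [J]. *)
Definition cylinder (J : pred I) : set (set Omega) :=
  [set A | exists (J' : {set I}) (B : I -> set R),
    [/\ forall i, i \in J' -> J i, forall i, i \in J' -> measurable (B i) &
        A = [set w | forall i, i \in J' -> B i (X i w)]]].

(** Phrased as measurability for a generated sigma-algebra, so that sums,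
    products and compositions of such functions are covered by the closure
    properties of measurable functions. *)
Definition depends_on (J : pred I) (f : Omega -> R) :=
  measurable_fun (setT : set (g_sigma_algebraType (cylinder J))) f.

Lemma cylinder_setI J : setI_closed (cylinder J).
Proof.
move=> _ _ [J1 [B1 [J1J mB1 ->]]] [J2 [B2 [J2J mB2 ->]]].
exists (J1 :|: J2)%SET, (fun i => (if i \in J1 then B1 i else setT) `&`
                              (if i \in J2 then B2 i else setT)).
split.
- by move=> i; rewrite inE => /orP[/J1J|/J2J].
- move=> i _; apply: measurableI; case: ifP => // h; [exact: mB1|exact: mB2].
- apply/seteqP; split=> w /=.
    move=> [h1 h2] i _; split; case: ifP => // h; [exact: h1|exact: h2].
  move=> h; split=> i hi; have := h i; rewrite inE hi ?orbT => /(_ isT) [];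
    by rewrite ?hi.
Qed.

Lemma cylinder_measurable J : cylinder J `<=` measurable.
Proof.
move=> _ [J' [B [_ mB ->]]].
rewrite (_ : [set _ | _] = \bigcap_(i in [set` J']) (X i @^-1` B i)); last first.
  by apply/seteqP; split=> w h i; exact: h.
apply: fin_bigcap_measurable => [|i /= hi]; first exact: finite_finset.
by rewrite -[X in measurable X]setTI; apply: measurable_funP => //; exact: mB.
Qed.

Lemma cylinder_sub (J J' : pred I) : (forall i, J i -> J' i) ->
  cylinder J `<=` cylinder J'.
Proof. by move=> h A [K [B [KJ mB ->]]]; exists K, B; split=> // i /KJ/h. Qed.

Lemma depends_on_sub (J J' : pred I) f : (forall i, J i -> J' i) ->
  depends_on J f -> depends_on J' f.
Proof.
move=> h mf _ B mB; have := mf measurableT B mB.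
exact: sub_sigma_algebra2 (cylinder_sub h) _.
Qed.

Lemma depends_on_measurable J f : depends_on J f -> measurable_fun setT f.
Proof.
move=> mf _ B mB; have := mf measurableT B mB.
apply: smallest_sub; last exact: cylinder_measurable.
exact: sigma_algebra_measurable.
Qed.

Lemma depends_on_var (J : pred I) i : J i -> depends_on J (X i).
Proof.
move=> Ji _ B mB; rewrite setTI; apply: sub_sigma_algebra.
exists [set i]%SET, (fun=> B); split=> //.
  by move=> j; rewrite inE => /eqP ->.
apply/seteqP; split=> w /= => [h j|]; first by rewrite inE => /eqP ->.
by apply; rewrite inE.
Qed.

Hypothesis indX : mutually_independent D X.

Lemma cylinder_independent (J1 J2 : pred I) A1 A2 :
  (forall i, J1 i -> D i) -> (forall i, J2 i -> D i) ->
  (forall i, J1 i -> ~~ J2 i) -> cylinder J1 A1 -> cylinder J2 A2 ->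
  P (A1 `&` A2) = (P A1 * P A2)%E.
Proof.
move=> J1D J2D J12 [K1 [B1 [K1J mB1 ->]]] [K2 [B2 [K2J mB2 ->]]].
have disj i : i \in K2 -> i \in K1 = false.
  by move=> /K2J h2; apply/negP => /K1J /J12; rewrite h2.
pose B i := if i \in K1 then B1 i else B2 i.
rewrite !indX //; [|by move=> i /K2J/J2D|by move=> i /K1J/J1D].
rewrite (_ : _ `&` _ = [set w | forall i, i \in (K1 :|: K2)%SET -> B i (X i w)]).
  rewrite indX => [|i|i]; last 2 first.
  - by rewrite inE => /orP[/K1J/J1D|/K2J/J2D].
  - by rewrite inE /B; case: ifP => [/mB1|_ /mB2].
  rewrite (bigID (mem K1)) /=; congr (_ * _)%E.
    apply: eq_big => i; first by rewrite inE; case: (i \in K1); rewrite ?andbF.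
    by move=> /andP[_ h]; rewrite /B h.
  apply: eq_big => i.
    by rewrite inE; have := disj i; case: (i \in K1); case: (i \in K2) => // ->.
  by move=> /andP[_ /negPf h]; rewrite /B h.
apply/seteqP; split=> w /=.
  by move=> [h1 h2] i; rewrite inE /B; case: ifP => [/h1|_ /h2].
move=> h; split=> i hi; have := h i; rewrite inE hi ?orbT /B => /(_ isT).
  by rewrite hi.
by rewrite (disj _ hi).
Qed.

(** Two applications of the pi-lambda theorem, one for each event. *)
Lemma sigma_independent (J1 J2 : pred I) A1 A2 :
  (forall i, J1 i -> D i) -> (forall i, J2 i -> D i) ->
  (forall i, J1 i -> ~~ J2 i) -> <<s cylinder J1 >> A1 -> <<s cylinder J2 >> A2 ->
  P (A1 `&` A2) = (P A1 * P A2)%E.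
Proof.
move=> J1D J2D J12 sA1 sA2.
have mA2 : measurable A2.
  move: sA2; apply: smallest_sub; last exact: cylinder_measurable.
  exact: sigma_algebra_measurable.
apply: (proj2 (@dynkin_independent (cylinder J1) _ _ _ _ _ _ sA1)) => //.
- exact: cylinder_setI.
- exact: cylinder_measurable.
move=> B1 cB1; rewrite setIC muleC.
apply: (proj2 (@dynkin_independent (cylinder J2) _ _ _ _ _ _ sA2)).
- exact: cylinder_setI.
- exact: cylinder_measurable.
- exact: cylinder_measurable cB1.
by move=> B2 cB2; rewrite setIC muleC; exact: (cylinder_independent (J1 := J1) (J2 := J2)).
Qed.

End Family.

Section TwoVariables.
Local Open Scope ereal_scope.
Variables (U V : Omega -> R).
Hypotheses (mU : measurable_fun setT U) (mV : measurable_fun setT V).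
Hypothesis indUV : forall A B, measurable A -> measurable B ->
  P (U @^-1` A `&` V @^-1` B) = P (U @^-1` A) * P (V @^-1` B).
Hypotheses (iU : P.-integrable setT (EFin \o U))
  (iV : P.-integrable setT (EFin \o V)).

Let rvU : {RV P >-> R} := HB.pack U (isMeasurableFun.Build _ _ _ _ U mU).
Let rvV : {RV P >-> R} := HB.pack V (isMeasurableFun.Build _ _ _ _ V mV).
Let UV (w : Omega) : R * R := (U w, V w).
Let mUV : measurable_fun setT UV. Proof. exact: measurable_fun_pair. Qed.
Let rvUV : {RV P >-> (R * R)%type} :=
  HB.pack UV (isMeasurableFun.Build _ _ _ _ UV mUV).

(** The joint law of independent variables is the product of their laws, so
    Fubini's theorem applies. *)
Lemma independent_mul :
  P.-integrable setT (fun w => (U w * V w)%:E) /\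
  \int[P]_w (U w * V w)%:E = (\int[P]_w (U w)%:E) * (\int[P]_w (V w)%:E).
Proof.
pose m1 : probability R R := distribution P rvU.
pose m2 : probability R R := distribution P rvV.
pose m : probability (R * R)%type R := distribution P rvUV.
have mE A : measurable A -> (m1 \x m2) A = m A.
  by apply: product_measure_unique => B C mB mC; rewrite -indUV.
pose g (z : R * R) : \bar R := (z.1 * z.2)%:E.
have mg : measurable_fun setT g.
  by apply/measurable_EFinP; apply: measurable_funM.
have i1 : m1.-integrable setT (EFin : R -> \bar R).
  by apply: integrable_pushforward.
have i2 : m2.-integrable setT (EFin : R -> \bar R).
  by apply: integrable_pushforward.
have ia1 : m1.-integrable setT (fun y : R => `|y%:E|) by exact: (integrable_abse i1).
have ia2 : m2.-integrable setT (fun y : R => `|y%:E|) by exact: (integrable_abse i2).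
have abs_fin (m' : probability R R) : m'.-integrable setT (EFin : R -> \bar R) ->
    exists a : R, \int[m']_y `|y%:E| = a%:E.
  move=> /integrable_abse /integrable_fin_num /= /(_ measurableT) h.
  by exists (fine (\int[m']_y `|y%:E|)); rewrite fineK.
have [a1 a1E] := abs_fin m1 i1; have [a2 a2E] := abs_fin m2 i2.
have inner x : \int[m2]_y `|g (x, y)| = a2%:E * `|x%:E|.
  rewrite -a2E muleC -(@integralZl _ _ _ m2 _ measurableT (fun y => `|y%:E|) ia2).
  by apply: eq_integral => y _; rewrite /g /= normrM.
have ig : (m1 \x m2).-integrable setT g.
  apply/integrable12ltyP => //=.
  under eq_integral do rewrite inner.
  rewrite (@integralZl _ _ _ m1 _ measurableT (fun y => `|y%:E|) ia1).
  by rewrite a1E -EFinM ltry.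
have eqm (f : R * R -> \bar R) : \int[m]_z f z = \int[m1 \x m2]_z f z.
  by apply: eq_measure_integral => A mA _; first [exact: mE | exact: (esym (mE A mA))].
have igm : m.-integrable setT g.
  apply/integrableP; split => //.
  by rewrite (eqm (abse \o g)); case/integrableP: ig.
have iP : P.-integrable setT (g \o UV).
  apply/integrableP; split; first exact: measurableT_comp.
  rewrite -(@ge0_integral_pushforward _ _ _ _ _ _ mUV P setT (abse \o g)) //.
  - by case/integrableP: igm.
  - exact: measurableT_comp.
  - by move=> y _; exact: abse_ge0.
have fin (f : Omega -> R) : P.-integrable setT (EFin \o f) ->
    exists a : R, \int[P]_w (f w)%:E = a%:E.
  move=> /integrable_fin_num /= /(_ measurableT) h.
  by exists (fine (\int[P]_w (f w)%:E)); rewrite fineK.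
have [a aE] := fin U iU; have [b bE] := fin V iV.
have e1 : \int[m1]_x x%:E = a%:E
  by rewrite -aE; apply: (integral_pushforward mU).
have e2 : \int[m2]_x x%:E = b%:E
  by rewrite -bE; apply: (integral_pushforward mV).
split; first exact: iP.
transitivity (\int[m]_z g z).
  by symmetry; apply: (integral_pushforward mUV).
rewrite eqm.
rewrite -integral12_prod_meas1 // /fubini_F /g /=.
have inner' x : \int[m2]_y (x * y)%:E = b%:E * x%:E.
  rewrite -e2 muleC -(@integralZl _ _ _ m2 _ measurableT EFin) //=.
under eq_integral do rewrite inner'.
by rewrite (@integralZl _ _ _ m1 _ measurableT EFin) // e1 aE bE muleC.
Qed.

End TwoVariables.

Section Product.
Context {I : finType} (D : pred I) (X : I -> {RV P >-> R}).
Hypothesis indX : mutually_independent D X.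

Lemma depends_on_mul (J1 J2 : pred I) (U V : Omega -> R) :
  (forall i, J1 i -> D i) -> (forall i, J2 i -> D i) ->
  (forall i, J1 i -> ~~ J2 i) -> depends_on X J1 U -> depends_on X J2 V ->
  P.-integrable setT (EFin \o U) -> P.-integrable setT (EFin \o V) ->
  P.-integrable setT (fun w => (U w * V w)%:E) /\
  (\int[P]_w (U w * V w)%:E = (\int[P]_w (U w)%:E) * (\int[P]_w (V w)%:E))%E.
Proof.
move=> J1D J2D J12 dU dV iU iV; apply: independent_mul => //.
- exact: depends_on_measurable dU.
- exact: depends_on_measurable dV.
move=> A B mA mB; apply: (sigma_independent indX J1D J2D J12).
  by have := dU measurableT A mA; rewrite setTI.
by have := dV measurableT B mB; rewrite setTI.
Qed.

Context {L : eqType} (lab : I -> L) (f : L -> Omega -> R).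
Let block (l : L) : pred I := [pred i | D i && (lab i == l)].
Hypothesis df : forall l, depends_on X (block l) (f l).
Hypothesis intf : forall l, P.-integrable setT (EFin \o f l).

Lemma depends_on_prod (s : seq L) :
  depends_on X [pred i | D i && (lab i \in s)] (fun w => \prod_(l <- s) f l w).
Proof.
elim: s => [|l s IH].
  rewrite (_ : (fun w => \prod_(l <- [::]) f l w) = cst 1); first exact: measurable_cst.
  by apply/funext => w; rewrite big_nil.
rewrite (_ : (fun w => \prod_(k <- l :: s) f k w) =
    (fun w => f l w * \prod_(k <- s) f k w)); last first.
  by apply/funext => w; rewrite big_cons.
apply: measurable_funM.
  apply: (depends_on_sub _ (@df l)) => i /= /andP[-> /eqP ->].
  by rewrite inE eqxx.
apply: (depends_on_sub _ IH) => i /= /andP[-> h].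
by rewrite inE h orbT.
Qed.

(** Blocks with distinct labels involve disjoint sets of variables. *)
Lemma expectation_prod (s : seq L) : uniq s ->
  P.-integrable setT (fun w => (\prod_(l <- s) f l w)%:E) /\
  (\int[P]_w (\prod_(l <- s) f l w)%:E = \prod_(l <- s) \int[P]_w (f l w)%:E)%E.
Proof.
elim: s => [_|l s IH /= /andP[ls us]].
  rewrite (_ : (fun w => _) = cst 1%E); last first.
    by apply/funext => w; rewrite big_nil.
  split; first exact: finite_measure_integrable_cst.
  by rewrite [LHS]integral_cst // mul1e [LHS]probability_setT big_nil.
have [iS eS] := IH us.
rewrite (_ : (fun w => _) = (fun w => (f l w * \prod_(k <- s) f k w)%:E)); last first.
  by apply/funext => w; rewrite big_cons.
have [] := @depends_on_mul (block l) [pred i | D i && (lab i \in s)] (f l)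
  (fun w => \prod_(k <- s) f k w) _ _ _ (@df l) (@depends_on_prod s) (intf l) iS.
- by move=> i /andP[].
- by move=> i /andP[].
- by move=> i /= /andP[-> /eqP ->]; rewrite (negPf ls).
by move=> iM ->; rewrite big_cons eS.
Qed.

End Product.

End Independence.

(** * First and second moments of the entries *)

Section Moments.
Context {disp : measure_display} {Omega : measurableType disp} {R : realType}.
Variable P : probability Omega R.

Lemma integrable_of_sqr (f : Omega -> R) : measurable_fun setT f ->
  P.-integrable setT (fun w => (f w ^+ 2)%:E) ->
  P.-integrable setT (EFin \o f).
Proof.
move=> mf if2.
apply: (@le_integrable _ _ _ P setT measurableT _ (fun w => (1 + f w ^+ 2)%:E)).
- exact/measurable_EFinP.
- move=> w _ /=; rewrite lee_fin [leRHS]ger0_norm ?addr_ge0 ?sqr_ge0 //.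
  by rewrite -real_normK ?num_real //; have := sqr_ge0 (`|f w| - 2^-1); lra.
- under eq_fun do rewrite EFinD.
  apply: integrableD => //; exact: finite_measure_integrable_cst.
Qed.

Lemma integrable_mul_of_sqr (f g : Omega -> R) :
  measurable_fun setT f -> measurable_fun setT g ->
  P.-integrable setT (fun w => (f w ^+ 2)%:E) ->
  P.-integrable setT (fun w => (g w ^+ 2)%:E) ->
  P.-integrable setT (fun w => (f w * g w)%:E).
Proof.
move=> mf mg if2 ig2.
apply: (@le_integrable _ _ _ P setT measurableT _ (fun w => (f w ^+ 2 + g w ^+ 2)%:E)).
- by apply/measurable_EFinP; exact: measurable_funM.
- move=> w _ /=; rewrite lee_fin [leRHS]ger0_norm ?addr_ge0 ?sqr_ge0 //.
  rewrite normrM -[f w ^+ 2]real_normK ?num_real // -[g w ^+ 2]real_normK ?num_real //.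
  by have := sqr_ge0 (`|f w| - `|g w|); have := sqr_ge0 (`|f w|); have := sqr_ge0 (`|g w|); lra.
- by under eq_fun do rewrite EFinD; apply: integrableD.
Qed.

End Moments.

Section StandardNormal.
Context {R : realType}.
Local Notation mu := (@lebesgue_measure R).
Local Notation nu := (normal_prob (0 : R) 1).

Lemma ge0_integral_std_normal (f : R -> \bar R) :
  measurable_fun setT f -> (forall x, 0 <= f x)%E ->
  (\int[nu]_x f x = \int[mu]_x (f x * (normal_pdf 0 1 x)%:E))%E.
Proof.
move=> mf f0.
have dom : nu `<< mu by exact: normal_prob_dominates.
rewrite -(Radon_Nikodym_SigmaFinite.change_of_variables dom f0 measurableT mf).
have iRN := Radon_Nikodym_SigmaFinite.f_integrable dom.
apply: ae_eq_integral => //.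
- by apply: emeasurable_funM => //; exact: measurable_int iRN.
- apply: emeasurable_funM => //; apply/measurable_EFinP.
  exact: measurable_normal_pdf.
- apply: ae_eqe_mul2l; apply: integral_ae_eq => //.
  + by apply/measurable_EFinP; exact: measurable_normal_pdf.
  + by move=> E _ mE; rewrite -Radon_Nikodym_SigmaFinite.f_integral.
Qed.

Lemma normal_pdf_tilt (m s x : R) : 0 < s ->
  s * normal_pdf m s x =
  normal_pdf 0 1 x * expR (x ^+ 2 / 2 - (x - m) ^+ 2 / (2 * s ^+ 2)).
Proof.
move=> s0; have sn0 : s != 0 by rewrite gt_eqF.
rewrite !normal_pdfE ?oner_eq0 // /normal_peak /normal_fun /=.
have -> : Num.sqrt (s ^+ 2 * pi *+ 2) = s * Num.sqrt (1 ^+ 2 * pi *+ 2).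
  by rewrite -mulrnAr sqrtrM ?sqr_ge0 // sqrtr_sqr ger0_norm ?ltW // expr1n mul1r.
rewrite -[RHS]mulrA -expRD invfM -[s^-1 * _ * _]mulrA mulVKf //.
congr (_ * expR _).
by rewrite -[s ^+ 2 *+ 2]mulr_natr -[1 ^+ 2 *+ 2]mulr_natr; field.
Qed.

Context {disp : measure_display} {Omega : measurableType disp}.
Variables (P : probability Omega R) (X : {RV P >-> R}).
Hypothesis gX : standard_gaussian X.

(* The normal law lives on [measurableTypeR R], hence a retyped copy of [X]. *)
Let mX' : measurable_fun setT (X : Omega -> measurableTypeR R).
Proof. exact: (measurable_funPT X). Qed.
Let X' : {RV P >-> measurableTypeR R} :=
  HB.pack (X : Omega -> measurableTypeR R) (isMeasurableFun.Build _ _ _ _ _ mX').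

Let integral_gX (f : R -> R) : measurable_fun setT f -> (forall x, 0 <= f x) ->
  (\int[P]_w (f (X w))%:E = \int[mu]_x (f x * normal_pdf 0 1 x)%:E)%E.
Proof.
move=> mf f0.
have mEf : measurable_fun (setT : set (measurableTypeR R)) (EFin \o f).
  exact/measurable_EFinP.
transitivity (\int[distribution P X']_x (EFin \o f) x)%E.
  by rewrite (ge0_integral_distribution X' mEf).
transitivity (\int[nu]_x (EFin \o f) x)%E.
  by apply: eq_measure_integral => A mA _; exact: gX.
by rewrite (@ge0_integral_std_normal (EFin \o f)).
Qed.

(** Tilting turns the standard normal density [phi] into [s] times the normal
    density with mean [m] and deviation [s]; since the tilt is at least one plus
    its exponent, integrating against [phi] bounds moments without computing
    any integral. *)
Lemma gaussian_tilt (m s : R) (u v : R -> R) : 0 < s ->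
  measurable_fun setT u -> measurable_fun setT v ->
  (forall x, 0 <= u x) -> (forall x, 0 <= v x) ->
  (forall x, u x <= 1 + (x ^+ 2 / 2 - (x - m) ^+ 2 / (2 * s ^+ 2)) + v x) ->
  (\int[P]_w (u (X w))%:E <= s%:E + \int[P]_w (v (X w))%:E)%E.
Proof.
move=> s0 mu_ mv u0 v0 H; rewrite !integral_gX //.
have mM (f g : R -> R) : measurable_fun setT f -> measurable_fun setT g ->
    measurable_fun (setT : set (measurableTypeR R)) (fun x => (f x * g x)%:E).
  by move=> mf mg; apply/measurable_EFinP; exact: (measurable_funM mf mg).
have mpdf a b : measurable_fun setT (normal_pdf (a : R) b).
  exact: measurable_normal_pdf.
have mcst : measurable_fun (setT : set R) (fun=> s : R) by exact: measurable_cst.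
have -> : s%:E = (\int[mu]_x (s * normal_pdf m s x)%:E)%E.
  under eq_integral do rewrite EFinM.
  rewrite integralZl //; last exact: integrable_normal_pdf.
  by rewrite integral_normal_pdf mule1.
rewrite -ge0_integralD //; last 4 first.
- by move=> x _; rewrite lee_fin mulr_ge0 ?normal_pdf_ge0 // ltW.
- exact: mM.
- by move=> x _; rewrite lee_fin mulr_ge0 ?normal_pdf_ge0.
- exact: mM.
apply: ge0_le_integral => //.
- by move=> x _; rewrite lee_fin mulr_ge0 ?normal_pdf_ge0.
- exact: mM.
- by apply: emeasurable_funD; exact: mM.
move=> x _; rewrite -EFinD lee_fin normal_pdf_tilt // (mulrC (u x)) (mulrC (v x)) -mulrDr.
rewrite ler_wpM2l ?normal_pdf_ge0 // (le_trans (H x)) // lerD2r.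
exact: expR_ge1Dx.
Qed.

(** Tilts with mean 0 and deviation [s] close to 1, above and below, bound
    [E X^2] by [2 s^2 / (1 + s)] from both sides. *)
Let EX2 : (\int[P]_w (X w ^+ 2)%:E = 1)%E.
Proof.
pose I := (\int[P]_w (X w ^+ 2)%:E)%E.
have I0 : (0 <= I)%E by apply: integral_ge0 => w _; rewrite lee_fin sqr_ge0.
have msq : measurable_fun setT (fun x : R => x ^+ 2) by exact: measurable_funX.
have mX2 : measurable_fun setT (fun w => (X w ^+ 2)%:E).
  by apply/measurable_EFinP; exact: measurable_funX.
have sc k : 0 <= k -> (\int[P]_w (k * X w ^+ 2)%:E = k%:E * I)%E.
  move=> k0; under eq_integral do rewrite EFinM.
  by rewrite ge0_integralZl_EFin // => w _; rewrite lee_fin sqr_ge0.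
have mc (a : R) : measurable_fun (setT : set R) (fun=> a) by exact: measurable_cst.
have mk k (a : R) : measurable_fun setT (fun x : R => a + k * x ^+ 2).
  by apply: measurable_funD => //; apply: measurable_funM.
have ub s : 1 < s -> (((1 - (s ^+ 2)^-1) / 2)%:E * I <= (s - 1)%:E)%E.
  move=> s1; pose k := (1 - (s ^+ 2)^-1) / 2.
  have s0 : 0 < s by rewrite (lt_trans _ s1).
  have k0 : 0 <= k.
    by rewrite divr_ge0 // subr_ge0 invf_le1 ?exprn_gt0 // exprn_ege1 // ltW.
  have p0 x : 0 <= 1 + k * x ^+ 2 by rewrite addr_ge0 // mulr_ge0 // sqr_ge0.
  have := @gaussian_tilt 0 s (fun x => 1 + k * x ^+ 2) (fun=> 0) s0 (mk k 1)
    (mc 0) p0 (fun=> lexx 0).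
  under eq_integral do rewrite EFinD.
  rewrite ge0_integralD //; last 2 first.
  - by move=> w _; rewrite lee_fin mulr_ge0 ?sqr_ge0.
  - by apply/measurable_EFinP; apply: measurable_funM => //; exact/measurable_EFinP.
  rewrite sc // integral0 adde0 integral_cst // mul1e [X in (X + _)%E]probability_setT.
  move=> H; rewrite EFinB leeBrDl //; apply: H => x.
  by rewrite addr0 subr0 lerD2l /k le_eqVlt; apply/orP; left; apply/eqP; field; rewrite gt_eqF.
have lb s : 0 < s < 1 -> ((1 - s)%:E <= (((s ^+ 2)^-1 - 1) / 2)%:E * I)%E.
  move=> /andP[s0 s1]; pose k := ((s ^+ 2)^-1 - 1) / 2.
  have k0 : 0 <= k.
    rewrite divr_ge0 // subr_ge0 invf_ge1 ?exprn_gt0 //.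
    by rewrite exprn_ile1 // ltW.
  have p0 x : 0 <= 0 + k * x ^+ 2 by rewrite add0r mulr_ge0 // sqr_ge0.
  have := @gaussian_tilt 0 s (fun=> 1) (fun x => 0 + k * x ^+ 2) s0
    (mc 1) (mk k 0) (fun=> ler01) p0.
  under [X in (_ <= _ + X)%E]eq_integral do rewrite add0r.
  rewrite sc // integral_cst // mul1e [X in (X <= _)%E]probability_setT.
  move=> H; rewrite EFinB leeBlDl //; apply: H => x.
  by rewrite subr0 add0r /k le_eqVlt; apply/orP; left; apply/eqP; field; rewrite gt_eqF.
have If : I \is a fin_num.
  rewrite ge0_fin_numE // ltey; apply/eqP => Iy.
  have := ub 2; rewrite Iy gt0_muley; last by rewrite lte_fin; lra.
  by rewrite ltr1n => /(_ isT).
have [i iE] : exists i, I = i%:E by exists (fine I); rewrite fineK.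
rewrite -/I iE; congr (_%:E); apply/eqP; rewrite eq_le; apply/andP; split.
  apply/ler_addgt0Pr => e e0.
  have [d d0 ->] : exists2 d, 0 < d & e = 2 * d by exists (e / 2); lra.
  have s2 : 0 < (1 + d) ^+ 2 by rewrite exprn_gt0 //; lra.
  have s2n : (1 + d) ^+ 2 != 0 by rewrite gt_eqF.
  have d1 : 1 < 1 + d by lra.
  have := ub (1 + d) d1; rewrite iE -EFinM lee_fin => /(ler_wpM2l (ltW s2)).
  have -> : (1 + d) ^+ 2 * ((1 - ((1 + d) ^+ 2)^-1) / 2 * i) =
    ((1 + d) ^+ 2 - 1) * i / 2 by field; rewrite -sqrf_eq0.
  move=> h; have dd : 0 < d * (2 + d) by rewrite mulr_gt0 //; lra.
  rewrite -(ler_pM2l dd); have := sqr_ge0 d; lra.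
apply/ler_addgt0Pr => e e0.
have i0 : 0 <= i by rewrite -lee_fin -iE.
have [e1|e1] := lerP 1 e; first by rewrite ler_wpDl.
have [d d0 eE] : exists2 d, 0 < d & e = 2 * d by exists (e / 2); lra.
have s2 : 0 < (1 - d) ^+ 2 by rewrite exprn_gt0 //; lra.
have s2n : (1 - d) ^+ 2 != 0 by rewrite gt_eqF.
have d1 : 0 < 1 - d < 1 by apply/andP; split; lra.
have := lb (1 - d) d1; rewrite iE -EFinM lee_fin => /(ler_wpM2l (ltW s2)).
have -> : (1 - d) ^+ 2 * ((((1 - d) ^+ 2)^-1 - 1) / 2 * i) =
  (1 - (1 - d) ^+ 2) * i / 2 by field; rewrite -sqrf_eq0.
move=> h; have dd : 0 < d * (2 - d) by rewrite mulr_gt0 //; lra.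
rewrite eE -(ler_pM2l dd); have := sqr_ge0 d; lra.
Qed.

Lemma gaussian_moments : [/\ P.-integrable setT (fun w => (X w ^+ 2)%:E),
  (\int[P]_w (X w)%:E = 0)%E & (\int[P]_w (X w ^+ 2)%:E = 1)%E].
Proof.
have iX2 : P.-integrable setT (fun w => (X w ^+ 2)%:E).
  apply/integrableP; split; first by apply/measurable_EFinP; exact: measurable_funX.
  under eq_integral do rewrite /= ger0_norm ?sqr_ge0 //.
  by rewrite EX2 ltry.
split=> //.
have iX : P.-integrable setT (EFin \o X) by exact: integrable_of_sqr.
pose pos (x : R) : R := Num.max x 0; pose neg (x : R) : R := Num.max (- x) 0.
have pos0 x : 0 <= pos x by rewrite le_max lexx orbT.
have neg0 x : 0 <= neg x by rewrite le_max lexx orbT.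
have mpos : measurable_fun setT pos by exact: measurable_maxr.
have mneg : measurable_fun setT neg by exact: measurable_maxr.
have posnegE x : x = pos x - neg x.
  rewrite /pos /neg; have [h|h] := lerP 0 x.
    by rewrite max_r ?oppr_le0 // subr0.
  by rewrite max_l ?oppr_ge0 ?(ltW h) // sub0r opprK.
have intf (f : R -> R) : measurable_fun setT f -> (forall x, 0 <= f x <= `|x|) ->
    P.-integrable setT (EFin \o (f \o X)).
  move=> mf fx; apply: (@le_integrable _ _ _ P setT measurableT _ (EFin \o X)) => //.
    by apply/measurable_EFinP; exact: measurableT_comp.
  by move=> w _ /=; rewrite lee_fin; have /andP[h1 h2] := fx (X w); rewrite ger0_norm.
have affine (f : R -> R) a m : measurable_fun setT f -> (forall x, 0 <= f x <= `|x|) ->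
    (\int[P]_w (a + m * f (X w))%:E = (a + m * fine (\int[P]_w (f (X w))%:E))%:E)%E.
  move=> mf fx; have i := intf f mf fx.
  under eq_integral do rewrite EFinD EFinM.
  rewrite integralD //; last exact: integrableZl.
    rewrite integral_cst // [X in (_ * X)%E]probability_setT mule1 integralZl //.
    by rewrite EFinD EFinM fineK // integrable_fin_num.
  exact: finite_measure_integrable_cst.
have posb x : 0 <= pos x <= `|x|.
  by rewrite pos0 /= ge_max ler_norm normr_ge0.
have negb x : 0 <= neg x <= `|x|.
  by rewrite neg0 /= ge_max -normrN ler_norm normr_ge0.
(* Tilting with deviation 1 and mean [e a], where [f - g = e x], gives
   [E f <= E g + a / 2]. *)
have cmp (f g : R -> R) : measurable_fun setT f -> measurable_fun setT g ->
    (forall x, 0 <= f x <= `|x|) -> (forall x, 0 <= g x <= `|x|) ->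
    (exists2 e : R, `|e| = 1 & forall x, f x = e * x + g x) ->
    fine (\int[P]_w (f (X w))%:E) <= fine (\int[P]_w (g (X w))%:E).
  move=> mf mg fx gx [e e1 fg]; apply/ler_addgt0Pr => d d0.
  pose a := 2 * d; have a0 : 0 < a by rewrite mulr_gt0.
  have maff (h : R -> R) b : measurable_fun setT h -> measurable_fun setT (fun x => b + a * h x).
    by move=> mh; apply: measurable_funD => //; apply: measurable_funM.
  have := @gaussian_tilt (e * a) 1 (fun x => 1 + a * f x) (fun x => a ^+ 2 / 2 + a * g x) ltr01
    (maff f 1 mf) (maff g (a ^+ 2 / 2) mg).
  have ee : e ^+ 2 = 1 by rewrite -real_normK ?num_real // e1 expr1n.
  have f0 x : 0 <= f x by case/andP: (fx x).
  have g0 x : 0 <= g x by case/andP: (gx x).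
  rewrite !affine // -EFinD lee_fin => H.
  have {}H : 1 + a * fine (\int[P]_w (f (X w))%:E) <=
      1 + (a ^+ 2 / 2 + a * fine (\int[P]_w (g (X w))%:E)).
    apply: H => x; first by rewrite addr_ge0 // mulr_ge0 // ltW.
      by rewrite addr_ge0 ?mulr_ge0 ?sqr_ge0 ?invr_ge0 // ltW.
    have -> : (x - e * a) ^+ 2 = x ^+ 2 - 2 * e * a * x + a ^+ 2.
      by rewrite sqrrB exprMn ee; ring.
    by rewrite fg expr1n; lra.
  by rewrite -(ler_pM2l a0); move: H; rewrite /a; lra.
rewrite (_ : (fun w => _) = (fun w => (pos (X w) - neg (X w))%:E)); last first.
  by apply/funext => w; rewrite -posnegE.
rewrite integralB_EFin //; last 2 first.
- exact: intf.
- exact: intf.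
have fp := integrable_fin_num measurableT (intf _ mpos posb).
have fn := integrable_fin_num measurableT (intf _ mneg negb).
rewrite -(fineK fp) -(fineK fn) -EFinB; congr (_%:E); apply/eqP.
rewrite subr_eq0 eq_le; apply/andP; split.
- apply: (cmp pos neg) => //; exists 1; first by rewrite normr1.
  by move=> x; rewrite {2}(posnegE x); ring.
- apply: (cmp neg pos) => //; exists (- 1); first by rewrite normrN1.
  by move=> x; rewrite {2}(posnegE x); ring.
Qed.

End StandardNormal.

Section Entries.
Context {disp : measure_display} {Omega : measurableType disp} {R : realType}.
Variables (P : probability Omega R) (X : {RV P >-> R}).

Lemma bernoulli_moments : signed_bernoulli X ->
  [/\ P.-integrable setT (fun w => (X w ^+ 2)%:E),
  (\int[P]_w (X w)%:E = 0)%E & (\int[P]_w (X w ^+ 2)%:E = 1)%E].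
Proof.
move=> [PA PB]; set A := X @^-1` [set 1] in PA; set B := X @^-1` [set -1] in PB.
have mA : measurable A by rewrite -[A]setTI; exact: measurable_funPT.
have mB : measurable B by rewrite -[B]setTI; exact: measurable_funPT.
have excl w : A w -> B w -> False.
  by move=> Aw Bw; have : (1 : R) = - 1 by [exact: etrans (esym Aw) Bw]; lra.
have AB : [disjoint A & B] by apply/disj_setPS => w [] /excl.
have ae : {ae P, forall w, A w \/ B w}.
  exists (~` (A `|` B)); split => //.
  - by apply: measurableC; apply: measurableU.
  - rewrite probability_setC; last exact: measurableU.
    rewrite measureU //; last exact/disj_set2P.
    have h : (P A + P B = 1)%E by rewrite PA PB -EFinD -[RHS]/(1%:E) [in RHS](splitr 1) mul1r.
    exact: (etrans (congr1 (fun z => 1 - z)%E h) (subee _)).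
have X2 : (\int[P]_w (X w ^+ 2)%:E = 1)%E.
  transitivity (\int[P]_w (cst 1 w : \bar R))%E; last first.
    by rewrite [LHS]integral_cst // mul1e [LHS]probability_setT.
  apply: ae_eq_integral => //.
    by apply/measurable_EFinP; exact: measurable_funX.
  by apply: filterS ae => w [|] /= -> _; rewrite ?sqrrN expr1n.
split=> //.
- apply/integrableP; split; first by apply/measurable_EFinP; exact: measurable_funX.
  under eq_integral do rewrite /= ger0_norm ?sqr_ge0 //.
  by rewrite X2 ltry.
- transitivity (\int[P]_w (\1_A w - \1_B w)%:E)%E.
    apply: ae_eq_integral => //.
    + exact/measurable_EFinP.
    + by apply/measurable_EFinP; apply: measurable_funB; exact: measurable_indic.
    + apply: filterS ae => w [] h _; rewrite !indicE /=.
        have -> : (w \in B) = false.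
          by apply/negbTE; rewrite notin_setE; exact: excl.
        by rewrite mem_set // subr0; have -> : X w = 1 by exact: h.
      have -> : (w \in A) = false.
        by apply/negbTE; rewrite notin_setE => /excl; exact.
      by rewrite mem_set // sub0r; have -> : X w = - 1 by exact: h.
  rewrite integralB_EFin //; last 2 first.
  - exact: integrable_indic.
  - exact: integrable_indic.
  rewrite !integral_indic // !setIT.
  exact: (etrans (congr2 (fun a b => a - b)%E PA PB) (subee _)).
Qed.

Lemma entry_moments : signed_bernoulli X \/ standard_gaussian X ->
  [/\ P.-integrable setT (fun w => (X w ^+ 2)%:E),
  (\int[P]_w (X w)%:E = 0)%E & (\int[P]_w (X w ^+ 2)%:E = 1)%E].
Proof. by case=> [/bernoulli_moments|/gaussian_moments]. Qed.

End Entries.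

(** * Exponential moments and concentration *)

Section ExponentialMoment.
Context {disp : measure_display} {Omega : measurableType disp} {R : realType}.
Variables (P : probability Omega R) (Y : Omega -> R).
Hypothesis mY : measurable_fun setT Y.

Let mYn n : measurable_fun setT (fun w => Y w ^+ n).
Proof. exact: measurable_funX. Qed.

Lemma psi2_norm_even_moment (L : R) (k : nat) : (0 < k)%N ->
  (psi2_norm P Y <= L%:E)%E ->
  (\int[P]_w (Y w ^+ (2 * k))%:E <= ((L ^+ 2 * (2 * k)%:R) ^+ k)%:E)%E.
Proof.
move=> k0 YL; pose p : R := (2 * k)%:R.
have p0 : 0 < p by rewrite ltr0n muln_gt0.
have pn0 : p != 0 by rewrite gt_eqF.
have NL : ((p `^ (- 2^-1))%:E * Lnorm P p%:E (EFin \o Y) <= L%:E)%E.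
  apply: le_trans YL; apply: ereal_sup_ubound; exists p => //=.
  by rewrite /p ler1n muln_gt0.
have sp0 : 0 < p `^ 2^-1 by rewrite powR_gt0.
have N0 : (0 <= Lnorm P p%:E (EFin \o Y))%E by exact: Lnorm_ge0.
have N1 : (Lnorm P p%:E (EFin \o Y) <= (L * p `^ 2^-1)%:E)%E.
  rewrite -(@lee_pmul2l _ (p `^ (- 2^-1))%:E) ?fin_numE // ?lte_fin ?powR_gt0 //.
  apply: le_trans NL _.
  by rewrite -EFinM lee_fin mulrCA powRN mulVf ?mulr1 // gt_eqF.
have L0 : 0 <= L.
  have := le_trans N0 N1; rewrite lee_fin pmulr_lge0 //.
have -> : (\int[P]_w (Y w ^+ (2 * k))%:E = Lnorm P p%:E (EFin \o Y) `^ p)%E.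
  rewrite poweR_Lnorm //; apply: eq_integral => w _ /=.
  rewrite /p powR_mulrn // -normrX ger0_norm // exprM.
  by rewrite exprn_ge0 // sqr_ge0.
apply: (@le_trans _ _ ((L * p `^ 2^-1)%:E `^ p)%E).
  apply: (gt0_ler_poweR (ltW p0)) => //;
    by rewrite in_itv /= ?N0 ?leey // lee_fin mulr_ge0 ?powR_ge0.
rewrite poweR_EFin lee_fin /p powR_mulrn ?mulr_ge0 ?powR_ge0 //.
have sq : ((2 * k)%:R `^ 2^-1) ^+ 2 = (2 * k)%:R :> R.
  by rewrite powR12_sqrt // sqr_sqrtr.
by rewrite [X in X <= _]exprM [(L * _) ^+ 2]exprMn sq.
Qed.

Lemma expR1_le4 : expR 1 <= 4 :> R.
Proof.
have h : expR (2^-1 : R) <= 2.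
  rewrite -[X in X <= _]invrK -expRN -[X in _ <= X]invrK lef_pV2 ?posrE ?invr_gt0 ?expR_gt0 //.
  by apply: le_trans (expR_ge1Dx _); lra.
have -> : (1 : R) = 2^-1 + 2^-1 by lra.
rewrite expRD; have := expR_gt0 (2^-1 : R); nra.
Qed.

Lemma pow_self_le_fact (k : nat) : (k%:R : R) ^+ k <= 4 ^+ k * k`!%:R.
Proof.
case: k => [|k]; first by rewrite !expr0 mul1r.
have := @expR_ge1Dxn R k.+1%:R k (ler0n _ _).
have -> : expR k.+1%:R = expR 1 ^+ k.+1 :> R by rewrite -expRM_natl mulr1.
move=> h; rewrite -ler_pdivrMr ?ltr0n ?fact_gt0 //.
apply: (@le_trans _ _ (expR 1 ^+ k.+1)); first by apply: le_trans h; rewrite lerDr.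
by rewrite lerXn2r ?nnegrE ?expR_ge0 // expR1_le4.
Qed.

(** The [k]-th term of the exponential series has expectation at most [2^-k],
    because [k^k <= 4^k k!]. *)
Lemma exponential_moment (L theta : R) : 0 <= theta -> theta * L ^+ 2 <= 16^-1 ->
  (psi2_norm P Y <= L%:E)%E ->
  (\int[P]_w (expR (theta * Y w ^+ 2))%:E <= 2%:E)%E.
Proof.
move=> t0 tL YL; pose x w := theta * Y w ^+ 2.
have x0 w : 0 <= x w by rewrite mulr_ge0 // sqr_ge0.
have mx : measurable_fun setT x by apply: measurable_funM.
have term k : (\int[P]_w (exp_coeff (x w) k)%:E <= (2^-1 ^+ k)%:E)%E.
  rewrite /exp_coeff /=; case: k => [|k].
    under eq_integral do rewrite expr0 fact0 divr1.
    by rewrite integral_cst // mul1e [X in (X <= _)%E]probability_setT.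
  have f0 : 0 <= theta ^+ k.+1 / k.+1`!%:R by rewrite divr_ge0 // exprn_ge0.
  rewrite (_ : (\int[P]_w _)%E = \int[P]_w ((theta ^+ k.+1 / k.+1`!%:R)%:E *
      (Y w ^+ (2 * k.+1))%:E))%E; last first.
    apply: eq_integral => w _; rewrite -EFinM; congr (_%:E).
    by rewrite /x exprMn exprM mulrAC.
  rewrite ge0_integralZl_EFin //; last 2 first.
  - by move=> w _; rewrite lee_fin exprM exprn_ge0 // sqr_ge0.
  - exact/measurable_EFinP.
  apply: le_trans (lee_wpmul2l _ (psi2_norm_even_moment (ltn0Sn k) YL)) _.
    by rewrite lee_fin.
  rewrite -EFinM lee_fin mulrAC ler_pdivrMr ?ltr0n ?fact_gt0 //.
  have q0 : 0 <= theta * L ^+ 2 by rewrite mulr_ge0 // sqr_ge0.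
  rewrite -exprMn natrM (_ : theta * _ = 2 * (theta * L ^+ 2) * k.+1%:R); last ring.
  rewrite exprMn; apply: le_trans (ler_wpM2l _ (pow_self_le_fact k.+1)) _.
    by rewrite exprn_ge0 // mulr_ge0.
  rewrite [leLHS]mulrA ler_wpM2r // -exprMn.
  have q1 : 0 <= 2 * (theta * L ^+ 2) * 4 by rewrite mulr_ge0 // mulr_ge0.
  by rewrite lerXn2r ?nnegrE ?q1 ?invr_ge0 //; lra.
pose S n w := series (exp_coeff (x w)) n.
have S0 n w : 0 <= S n w by apply: sumr_ge0 => i _; exact: exp_coeff_ge0.
have SS n w : S n.+1 w = S n w + exp_coeff (x w) n by rewrite /S seriesSr.
have mc n : measurable_fun setT (fun w => exp_coeff (x w) n).
  by apply: measurable_funM => //; apply: measurable_funX.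
have mS n : measurable_fun setT (S n).
  elim: n => [|n IH].
    rewrite (_ : S 0%N = cst 0) //; apply/funext => w.
    by rewrite /S /series /= big_geq.
  rewrite (_ : S n.+1 = (fun w => S n w + exp_coeff (x w) n)); last exact/funext/SS.
  exact: measurable_funD.
have iS n : (\int[P]_w (S n w)%:E <= (\sum_(k < n) 2^-1 ^+ k)%:E)%E.
  elim: n => [|n IH].
    rewrite big_ord0 integral0_eq // => w _.
    by rewrite /S /series /= big_geq.
  under eq_integral do rewrite SS EFinD.
  rewrite ge0_integralD //; last 4 first.
  - by move=> w _; rewrite lee_fin.
  - exact/measurable_EFinP.
  - by move=> w _; rewrite lee_fin exp_coeff_ge0.
  - exact/measurable_EFinP.
  by rewrite big_ord_recr /= EFinD leeD.
rewrite (_ : (\int[P]_w _)%E = \int[P]_w (limn (fun n => (S n w)%:E)))%E; last first.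
  apply: eq_integral => w _; rewrite -/(x w) EFin_lim //.
  exact: is_cvg_series_exp_coeff.
rewrite monotone_convergence //; last 3 first.
- by move=> n; exact/measurable_EFinP.
- by move=> n w _; rewrite lee_fin.
- move=> w _; apply/nondecreasing_seqP => n.
  by rewrite lee_fin SS lerDl exp_coeff_ge0.
apply: lime_le.
  apply: ereal_nondecreasing_is_cvgn; apply/nondecreasing_seqP => n.
  apply: ge0_le_integral => //.
  - by move=> w _; rewrite lee_fin.
  - exact/measurable_EFinP.
  - exact/measurable_EFinP.
  - by move=> w _; rewrite lee_fin SS lerDl exp_coeff_ge0.
apply: nearW => n; apply: le_trans (iS n) _.
by rewrite lee_fin sum_half_pow_le2.
Qed.

Lemma expR_le_quadratic (u : R) : expR u <= 1 + u + u ^+ 2 * expR `|u|.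
Proof.
have [u0|u0] := lerP 0 u.
  have e1 : expR u <= 1 + u * expR u.
    have := expR_ge1Dx (- u); rewrite expRN => h.
    have := ler_wpM2r (ltW (expR_gt0 u)) h; rewrite mulVf ?gt_eqF ?expR_gt0 //; lra.
  by have := ler_wpM2l u0 e1; rewrite (ger0_norm u0); lra.
have h : expR u <= (1 - u)^-1.
  rewrite -[u in expR u]opprK expRN lef_pV2 ?posrE ?expR_gt0 //; last lra.
  exact: expR_ge1Dx.
apply: le_trans h _; rewrite (ltr0_norm u0) -[X in X <= _]mul1r ler_pdivrMr; last lra.
have : 1 <= expR (- u) by rewrite -[X in X <= _]expR0 ler_expR; lra.
have := sqr_ge0 u.
move=> h1 h2; have h3 : 0 <= (1 - u) * u ^+ 2 * (expR (- u) - 1).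
  by apply: mulr_ge0; [apply: mulr_ge0 => //; lra|lra].
have h4 : 0 <= u ^+ 2 * (- u) by apply: mulr_ge0 => //; lra.
by lra.
Qed.

(** A second order expansion of the exponential; the remainder
    [lam^2 Y^4 exp (|lam| Y^2)] is absorbed by [exp (2 c Y^2)], whose
    expectation is at most 2. *)
Lemma sqr_mgf_bound (c lam s : R) : 0 < c ->
  (\int[P]_w (expR (2 * c * Y w ^+ 2))%:E <= 2%:E)%E ->
  (\int[P]_w (Y w ^+ 2)%:E = s%:E)%E -> `|lam| <= c ->
  (\int[P]_w (expR (lam * Y w ^+ 2))%:E
     <= (expR (lam * s + 4 * (lam / c) ^+ 2))%:E)%E.
Proof.
move=> c0 em Ys lamc.
pose k : R := 2 * (lam / c) ^+ 2.
have k0 : 0 <= k by rewrite mulr_ge0 // sqr_ge0.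
have pw w : expR (lam * Y w ^+ 2) <=
    1 + lam * Y w ^+ 2 + k * expR (2 * c * Y w ^+ 2).
  set y := Y w ^+ 2; have y0 : 0 <= y by exact: sqr_ge0.
  apply: le_trans (expR_le_quadratic _) _; rewrite lerD2l.
  rewrite normrM (ger0_norm y0).
  have e1 : (c * y) ^+ 2 <= 2 * expR (c * y).
    have := @expR_ge1Dxn R (c * y) 1 (mulr_ge0 (ltW c0) y0).
    rewrite (_ : 2`! = 2%N) //; lra.
  have e2 : expR (`|lam| * y) <= expR (c * y) by rewrite ler_expR ler_wpM2r.
  have -> : 2 * c * y = c * y + c * y by ring.
  rewrite expRD; apply: (@le_trans _ _ ((lam * y) ^+ 2 * expR (c * y))).
    by rewrite ler_wpM2l ?sqr_ge0.
  rewrite mulrA ler_wpM2r ?expR_ge0 //.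
  have -> : (lam * y) ^+ 2 = (lam / c) ^+ 2 * (c * y) ^+ 2.
    by field; rewrite gt_eqF.
  by have := ler_wpM2l (sqr_ge0 (lam / c)) e1; rewrite /k; lra.
have mE (th : R) : measurable_fun setT (fun w => expR (th * Y w ^+ 2)).
  apply: (@measurableT_comp _ _ _ _ R R (@expR R)); first exact: measurable_expR.
  exact: measurable_funM.
have iE (th : R) : (\int[P]_w (expR (th * Y w ^+ 2))%:E < +oo)%E ->
    P.-integrable setT (fun w => (expR (th * Y w ^+ 2))%:E).
  move=> h; apply/integrableP; split; first exact/measurable_EFinP.
  by under eq_integral do rewrite /= ger0_norm ?expR_ge0 //.
have i2 : P.-integrable setT (fun w => (Y w ^+ 2)%:E).
  apply/integrableP; split; first exact/measurable_EFinP.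
  under eq_integral do rewrite /= ger0_norm ?sqr_ge0 //.
  by rewrite Ys ltry.
have i3 := iE (2 * c) (le_lt_trans em (ltry _)).
have i1 : P.-integrable setT (cst (1%:E : \bar R)) by exact: finite_measure_integrable_cst.
have i4 : P.-integrable setT (fun w => (1 + lam * Y w ^+ 2)%:E).
  under eq_fun do rewrite EFinD EFinM.
  by apply: integrableD => //; exact: integrableZl.
have i5 : P.-integrable setT (fun w => (k * expR (2 * c * Y w ^+ 2))%:E).
  by under eq_fun do rewrite EFinM; exact: integrableZl.
apply: (@le_trans _ _ (\int[P]_w (1 + lam * Y w ^+ 2 + k * expR (2 * c * Y w ^+ 2))%:E)%E).
  apply: ge0_le_integral => //.
  - exact/measurable_EFinP.
  - apply/measurable_EFinP; apply: measurable_funD; last exact: measurable_funM.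
    by apply: measurable_funD => //; exact: measurable_funM.
  - by move=> w _; rewrite lee_fin.
under eq_integral do rewrite EFinD.
rewrite integralD //.
have -> : (\int[P]_w (1 + lam * Y w ^+ 2)%:E = (1 + lam * s)%:E)%E.
  under eq_integral do rewrite EFinD EFinM.
  rewrite integralD //; last exact: integrableZl.
  rewrite integral_cst // [X in (_ * X + _)%E]probability_setT mule1.
  by rewrite integralZl // Ys -EFinM -EFinD.
under eq_integral do rewrite EFinM.
rewrite integralZl //.
apply: (@le_trans _ _ ((1 + lam * s)%:E + k%:E * 2%:E)%E).
  by rewrite leeD2l // lee_wpmul2l ?lee_fin.
rewrite -EFinM -EFinD lee_fin; apply: le_trans (expR_ge1Dx _).
by rewrite /k; lra.
Qed.

End ExponentialMoment.

Lemma measurable_superlevel {disp : measure_display}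
    {Omega : measurableType disp} {R : realType} (f : Omega -> R) (a : R) :
  measurable_fun setT f -> measurable [set w | a <= f w].
Proof.
move=> mf; rewrite (_ : [set _ | _] = setT `&` f @^-1` `[a, +oo[%classic).
  by apply: mf => //; exact: measurable_itv.
by rewrite setTI; apply/seteqP; split=> w /=; rewrite in_itv /= andbT.
Qed.

Section Concentration.
Context {disp : measure_display} {Omega : measurableType disp} {R : realType}.
Variables (P : probability Omega R).
Context {I : finType} (D : pred I) (X : I -> {RV P >-> R}).
Hypothesis indX : mutually_independent D X.
Context {N : nat} (lab : I -> 'I_N) (Y : 'I_N -> Omega -> R).
Hypothesis dY : forall l, depends_on X [pred i | D i && (lab i == l)] (Y l).
Variables (s c e : R).
Hypotheses (c0 : 0 < c) (e0 : 0 < e) (ce : c * e <= 8).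
Hypothesis mgf : forall l lam, `|lam| <= c ->
  (\int[P]_w (expR (lam * Y l w ^+ 2))%:E
     <= (expR (lam * s + 4 * (lam / c) ^+ 2))%:E)%E.

Let mY l : measurable_fun setT (Y l).
Proof. exact: depends_on_measurable (@dY l). Qed.

Let T w := \sum_l Y l w ^+ 2.

Let mT : measurable_fun setT T.
Proof. by apply: measurable_sum => l; exact: measurable_funX. Qed.

Let depE lam l :
  depends_on X [pred i | D i && (lab i == l)] (fun w => expR (lam * Y l w ^+ 2)).
Proof.
apply: (@measurableT_comp _ _ _ _ R R (@expR R)); first exact: measurable_expR.
apply: measurable_funM; first exact: measurable_cst.
by apply: measurable_funX; exact: (@dY l).
Qed.

Let mgfT lam : `|lam| <= c ->
  (\int[P]_w (expR (lam * T w))%:E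
     <= (expR (N%:R * (lam * s + 4 * (lam / c) ^+ 2)))%:E)%E.
Proof.
move=> lc.
have iE l : P.-integrable setT (EFin \o (fun w => expR (lam * Y l w ^+ 2))).
  have mE := depends_on_measurable (@depE lam l).
  apply/integrableP; split; first exact/measurable_EFinP.
  under eq_integral do rewrite /= ger0_norm ?expR_ge0 //.
  exact: le_lt_trans (mgf l lc) (ltry _).
have [_ eq] := expectation_prod indX (depE lam) iE (index_enum_uniq 'I_N).
rewrite (_ : (\int[P]_w _)%E =
    \int[P]_w (\prod_(l <- index_enum 'I_N) expR (lam * Y l w ^+ 2))%:E)%E; last first.
  by apply: eq_integral => w _; rewrite -expR_sum /T mulr_sumr.
pose v l := fine (\int[P]_w (expR (lam * Y l w ^+ 2))%:E).
have vE l : (\int[P]_w (expR (lam * Y l w ^+ 2))%:E = (v l)%:E)%E.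
  by rewrite /v fineK // (integrable_fin_num measurableT (iE l)).
rewrite eq (eq_bigr _ (fun l _ => vE l)) prodEFin lee_fin.
rewrite expRM_natl -[X in _ ^+ X](card_ord N) -prodr_const.
apply: ler_prod => l _; rewrite -!lee_fin -vE mgf // andbT.
by apply: integral_ge0 => w _; rewrite lee_fin expR_ge0.
Qed.

(** Markov's inequality for [exp (lam (T - N s))], [lam = +- c^2 e / 8]. *)
Lemma chernoff_sqr_sum :
  (P [set w | (N%:R * e <= `|\sum_l Y l w ^+ 2 - N%:R * s|)%R]
     <= (2 * expR (- (N%:R * (c ^+ 2 * e ^+ 2 / 16))))%:E)%E.
Proof.
pose A (sg : R) := [set w | N%:R * e <= sg * (T w - N%:R * s)].
have mTs : measurable_fun setT (fun w => T w - N%:R * s) by exact: measurable_funB.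
have mA sg : measurable (A sg) by apply: measurable_superlevel; exact: measurable_funM.
have PA (sg : R) : `|sg| = 1 -> (P (A sg) <= (expR (- (N%:R * (c ^+ 2 * e ^+ 2 / 16))))%:E)%E.
  move=> s1; pose m := c ^+ 2 * e / 8; pose lam := sg * m.
  have m0 : 0 <= m by rewrite !mulr_ge0 ?sqr_ge0 ?invr_ge0 // ltW.
  have lc : `|lam| <= c.
    rewrite normrM s1 mul1r ger0_norm // /m.
    by have := ler_wpM2l (ltW c0) ce; lra.
  have sg2 : sg ^+ 2 = 1 by rewrite -real_normK ?num_real // s1 expr1n.
  pose k := expR (- (lam * (N%:R * s)) - m * (N%:R * e)).
  have mexp : measurable_fun setT (fun w => (expR (lam * T w))%:E).
    apply/measurable_EFinP.
    apply: (@measurableT_comp _ _ _ _ R R (@expR R)); first exact: measurable_expR.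
    exact: measurable_funM.
  have -> : P (A sg) = (\int[P]_w (\1_(A sg) w)%:E)%E.
    by rewrite integral_indic // setIT.
  apply: (@le_trans _ _ (\int[P]_w (k%:E * (expR (lam * T w))%:E))%E).
    apply: ge0_le_integral => //.
    - by apply/measurable_EFinP; exact: measurable_indic.
    - exact: emeasurable_funM.
    move=> w _; rewrite -EFinM lee_fin indicE.
    have [|_] := boolP (w \in A sg); last by rewrite mulr_ge0 ?expR_ge0.
    rewrite inE /= => /(ler_wpM2l m0) h.
    rewrite -expRD -[X in X <= _]expR0 ler_expR /lam; move: h; rewrite -/(T w); lra.
  rewrite ge0_integralZl_EFin ?expR_ge0 //.
  apply: le_trans (lee_wpmul2l _ (mgfT lc)) _; first by rewrite lee_fin expR_ge0.
  rewrite -EFinM lee_fin -expRD ler_expR /lam /m.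
  rewrite (_ : (sg * _ / c) ^+ 2 = sg ^+ 2 * (c * e / 8) ^+ 2); last by field; rewrite gt_eqF.
  by rewrite sg2; lra.
apply: (@le_trans _ _ (P (A 1 `|` A (- 1)))).
  apply: le_measure; rewrite ?inE //.
  - by apply: measurable_superlevel; apply: measurableT_comp.
  - exact: measurableU.
  - move=> w /=; rewrite /A /= mul1r mulN1r -/(T w).
    by case: (ger0P (T w - N%:R * s)) => _ ?; [left|right].
apply: le_trans (measureU2 _ _ _) _ => //.
by rewrite mulr_natl mulr2n EFinD; apply: leeD; apply: PA; rewrite ?normrN1 ?normr1.
Qed.

End Concentration.

(** * The rows of the randomized matrix *)

Section LinearCombination.
Context {disp : measure_display} {Omega : measurableType disp} {R : realType}.
Variable P : probability Omega R.

Lemma integral_lincomb (J : Type) (s : seq J) (a : J -> R) (f : J -> Omega -> R)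
    (v : J -> R) :
  (forall j, P.-integrable setT (EFin \o f j)) ->
  (forall j, (\int[P]_w (f j w)%:E = (v j)%:E)%E) ->
  P.-integrable setT (fun w => (\sum_(j <- s) a j * f j w)%:E) /\
  (\int[P]_w (\sum_(j <- s) a j * f j w)%:E = (\sum_(j <- s) a j * v j)%:E)%E.
Proof.
move=> intf vE; elim: s => [|j s [IH1 IH2]].
  rewrite (_ : (fun w => _) = cst 0%E); last first.
    by apply/funext => w; rewrite big_nil.
  by split; [exact: integrable0|rewrite integral0 big_nil].
rewrite (_ : (fun w => _) =
  (fun w => (a j)%:E * (f j w)%:E + (\sum_(j <- s) a j * f j w)%:E)%E); last first.
  by apply/funext => w; rewrite big_cons EFinD EFinM.
have iz : P.-integrable setT (fun w => ((a j)%:E * (f j w)%:E)%E).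
  by apply: integrableZl => //; exact: intf.
split; first exact: integrableD.
by rewrite integralD // integralZl ?vE ?IH2 ?big_cons //; exact: intf.
Qed.

Lemma mutually_independent_sub (I : finType) (D D' : pred I) (X : I -> {RV P >-> R}) :
  (forall i, D' i -> D i) -> mutually_independent D X -> mutually_independent D' X.
Proof. by move=> D'D indX J A JD'; apply: indX => i /JD'/D'D. Qed.

End LinearCombination.

Section RandomizedMatrix.
Context {R : realType} (d : nat) (k : 'I_d) (r r' : nat) (M : 'I_d -> nat).
Variable F : forall i : 'I_d, 'M[R]_(M i, r).
Context (disp : measure_display) (Omega : measurableType disp).
Variable P : probability Omega R.
Variable X : forall i : 'I_d, 'I_(M i) -> 'I_r' -> {RV P >-> R}.
Arguments X : clear implicits.

Local Notation idx := {i : 'I_d & ('I_(M i) * 'I_r')%type}.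
Let Xe (e : idx) := X (tag e) (tagged e).1 (tagged e).2.
Let D : pred idx := fun e => tag e != k.
Let lab (e : idx) : 'I_r' := (tagged e).2.
Let B (w : Omega) : 'M[R]_(r', r) :=
  randomized_ALS_matrix k F (fun i => \matrix_(m, l) X i m l w).

Hypothesis indX : mutually_independent D Xe.
Hypothesis momX : forall i (m : 'I_(M i)) (l : 'I_r'), i != k ->
  signed_bernoulli (X i m l) \/ standard_gaussian (X i m l).

Let V i (a : 'I_r) l w := \sum_m F i m a * X i m l w.

Let BE w l a : B w l a = \prod_(i | i != k) V i a l w.
Proof.
rewrite mxE; apply: eq_bigr => i _; rewrite dotE; apply: eq_bigr => m _.
by rewrite !mxE.
Qed.

Let V_depends i a l : i != k ->
  depends_on Xe [pred e | (D e && (lab e == l)) && (tag e == i)] (V i a l).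
Proof.
move=> ik; apply: measurable_sum => m; apply: measurable_funM.
  exact: measurable_cst.
apply: (@depends_on_var _ _ _ _ _ Xe _ (existT _ i (m, l))) => /=.
by rewrite /D /lab /= ik !eqxx.
Qed.

Let B_depends l a :
  depends_on Xe [pred e | D e && (lab e == l)] (fun w => B w l a).
Proof.
rewrite (_ : (fun w => _) =
    (fun w => \prod_(i <- index_enum 'I_d) (if i != k then V i a l w else 1))); last first.
  by apply/funext => w; rewrite BE big_mkcond.
apply: measurable_prod => i _.
case: (boolP (i != k)) => [ik|_]; last exact: measurable_cst.
by apply: (depends_on_sub _ (@V_depends i a l ik)) => e /= /andP[].
Qed.

Let mX2 i m l : i != k -> P.-integrable setT (fun w => (X i m l w ^+ 2)%:E).
Proof. by move=> ik; have [] := entry_moments (momX m l ik). Qed.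

Let cov i m m' l : i != k ->
  P.-integrable setT (EFin \o (fun w => X i m l w * X i m' l w)) /\
  (\int[P]_w (X i m l w * X i m' l w)%:E = ((m == m')%:R : R)%:E)%E.
Proof.
move=> ik; split; first by apply: integrable_mul_of_sqr => //; exact: mX2.
have [<-|mm] := eqVneq m m'.
  by have [_ _ <-] := entry_moments (momX m l ik); apply: eq_integral => w _; rewrite expr2.
pose e : idx := existT _ i (m, l); pose e' : idx := existT _ i (m', l).
have ee : e != e'.
  by apply: contra mm; rewrite eq_Tagged /= => /eqP [->].
have i1 (q : 'I_(M i)) : P.-integrable setT (EFin \o X i q l).
  by apply: integrable_of_sqr => //; exact: mX2.
have [] := @depends_on_mul _ _ _ P _ D Xe indX (pred1 e) (pred1 e') (X i m l) (X i m' l).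
- by move=> z /eqP ->.
- by move=> z /eqP ->.
- by move=> z /= /eqP ->.
- exact: (@depends_on_var _ _ _ _ _ Xe (pred1 e) e (eqxx e)).
- exact: (@depends_on_var _ _ _ _ _ Xe (pred1 e') e' (eqxx e')).
- exact: i1.
- exact: i1.
by move=> _ ->; have [_ -> _] := entry_moments (momX m l ik); rewrite mul0e.
Qed.

Let V_cov i a b l : i != k ->
  P.-integrable setT (EFin \o (fun w => V i a l w * V i b l w)) /\
  (\int[P]_w (V i a l w * V i b l w)%:E = (dot (col a (F i)) (col b (F i)))%:E)%E.
Proof.
move=> ik.
pose c (p : 'I_(M i) * 'I_(M i)) := F i p.1 a * F i p.2 b.
pose f (p : 'I_(M i) * 'I_(M i)) w := X i p.1 l w * X i p.2 l w.
have VE w : V i a l w * V i b l w = \sum_p c p * f p w.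
  rewrite /V mulr_suml -(pair_bigA _ (fun m m' => c (m, m') * f (m, m') w)) /=.
  apply: eq_bigr => m _; rewrite mulr_sumr; apply: eq_bigr => m' _.
  by rewrite /c /f /= mulrACA.
have [h1 h2] := integral_lincomb (index_enum _) c
  (fun p => proj1 (cov p.1 p.2 l ik)) (fun p => proj2 (cov p.1 p.2 l ik)).
rewrite (_ : EFin \o _ = (fun w => (\sum_p c p * f p w)%:E)); last first.
  by apply/funext => w /=; rewrite VE.
split; first exact: h1.
rewrite (_ : (fun w => _) = (fun w => (\sum_p c p * f p w)%:E)); last first.
  by apply/funext => w /=; rewrite VE.
rewrite h2; congr (_%:E).
rewrite -(pair_bigA _ (fun m m' => c (m, m') * (m == m')%:R)) /= dotE.
apply: eq_bigr => m _; rewrite (bigD1 m) //= eqxx mulr1 big1 ?addr0 ?mxE //.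
by move=> m' mm'; rewrite eq_sym (negPf mm') mulr0.
Qed.

(** Within a row the factors with different indices [i] are independent, so
    the second moments of the entries multiply up to the standard matrix. *)
Let B_cov l a b :
  P.-integrable setT (EFin \o (fun w => B w l a * B w l b)) /\
  (\int[P]_w (B w l a * B w l b)%:E = (ALS_matrix k F a b)%:E)%E.
Proof.
pose f i w := if i != k then V i a l w * V i b l w else 1.
pose D' : pred idx := fun e => D e && (lab e == l).
have indX' : mutually_independent D' Xe.
  by apply: mutually_independent_sub indX => e /andP[].
have df i : depends_on Xe [pred e | D' e && (tag e == i)] (f i).
  rewrite /f; case: (boolP (i != k)) => [ik|_]; last exact: measurable_cst.
  by apply: measurable_funM; exact: (@V_depends i _ l ik).
have intf i : P.-integrable setT (EFin \o f i).
  rewrite /f; case: (boolP (i != k)) => [ik|_]; last exact: finite_measure_integrable_cst.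
  exact: (proj1 (V_cov a b l ik)).
have [h1 h2] := expectation_prod indX' df intf (index_enum_uniq 'I_d).
have E w : B w l a * B w l b = \prod_(i <- index_enum 'I_d) f i w.
  by rewrite !BE -big_split /= big_mkcond.
rewrite (_ : EFin \o _ = (fun w => (\prod_(i <- index_enum 'I_d) f i w)%:E)); last first.
  by apply/funext => w /=; rewrite E.
split; first exact: h1.
rewrite (_ : (fun w => _) = (fun w => (\prod_(i <- index_enum 'I_d) f i w)%:E)); last first.
  by apply/funext => w /=; rewrite E.
rewrite h2 mxE -prodEFin [RHS]big_mkcond /=; apply: eq_bigr => i _.
rewrite /f; case: (boolP (i != k)) => [ik|_].
  by rewrite (proj2 (V_cov a b l ik)) dotC.
by rewrite [LHS]integral_cst // mul1e [LHS]probability_setT.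
Qed.

Lemma row_second_moment l (v : 'cV[R]_r) :
  (\int[P]_w (dot (row l (B w))^T v ^+ 2)%:E = (dot v (ALS_matrix k F *m v))%:E)%E.
Proof.
pose c (p : 'I_r * 'I_r) := v p.1 0 * v p.2 0.
pose f (p : 'I_r * 'I_r) w := B w l p.1 * B w l p.2.
have [_ h2] := integral_lincomb (index_enum _) c
  (fun p => proj1 (B_cov l p.1 p.2)) (fun p => proj2 (B_cov l p.1 p.2)).
rewrite (_ : (fun w => _) = (fun w => (\sum_p c p * f p w)%:E)); last first.
  apply/funext => w; rewrite expr2 dotE mulr_suml; congr (_%:E).
  rewrite -(pair_bigA _ (fun a b => c (a, b) * f (a, b) w)) /=.
  apply: eq_bigr => a _; rewrite mulr_sumr; apply: eq_bigr => b _.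
  by rewrite /c /f /= !mxE mulrACA mulrC.
rewrite h2 dotE -(pair_bigA _ (fun a b => c (a, b) * ALS_matrix k F a b)) /=.
congr (_%:E); apply: eq_bigr => a _; rewrite [(_ *m _) _ _]mxE mulr_sumr.
by apply: eq_bigr => b _; rewrite /c /= -mulrA [v b 0 * _]mulrC.
Qed.

Lemma row_depends l (v : 'cV[R]_r) :
  depends_on Xe [pred e | D e && (lab e == l)] (fun w => dot (row l (B w))^T v).
Proof.
rewrite (_ : (fun w => _) = (fun w => \sum_a v a 0 * B w l a)); last first.
  by apply/funext => w; rewrite dotE; apply: eq_bigr => a _; rewrite !mxE mulrC.
apply: measurable_sum => a; apply: measurable_funM; first exact: measurable_cst.
exact: B_depends.
Qed.

Lemma row_deviation_measurable (v : 'cV[R]_r) (s e : R) :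
  measurable [set w | e <= `|\sum_l dot (row l (B w))^T v ^+ 2 - s|].
Proof.
apply: measurable_superlevel; apply: measurableT_comp => //.
apply: measurable_funB => //; apply: measurable_sum => l.
by apply: measurable_funX; exact: depends_on_measurable (@row_depends l v).
Qed.

Section Deviation.
Variables (S : 'M[R]_r) (K : R).
Let rho := spectral_norm (invmx S).
Let c0 := (32 * (1 + (K * rho) ^+ 2))^-1.
Hypotheses (uS : S \in unitmx) (sS : S^T = S) (SS : S *m S = ALS_matrix k F).
Hypothesis psiK : forall l, (psi2_norm_vec P (fun w => (row l (B w))^T) <= K%:E)%E.

Let c0_gt0 : 0 < c0.
Proof. by rewrite invr_gt0 mulr_gt0 // ltr_wpDr ?sqr_ge0. Qed.

(** [x] ranges over the images [S^-1 y] with [|y| <= 1], whose norm is at most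
    [rho]; rescaling to a unit vector brings in the sub-Gaussian norm. *)
Let row_exponential_moment l (y : 'cV[R]_r) : dot y y <= 1 ->
  (\int[P]_w (expR (2 * c0 * dot (row l (B w))^T (invmx S *m y) ^+ 2))%:E <= 2%:E)%E.
Proof.
move=> y1; set v := invmx S *m y.
have [v0|v0] := eqVneq v 0.
  under eq_integral do rewrite v0 dotC dot0l expr0n mulr0 expR0.
  by rewrite integral_cst // mul1e [X in (X <= _)%E]probability_setT lee_fin ler1n.
have n0 : 0 < enorm v by rewrite enorm_gt0.
pose u := (enorm v)^-1 *: v.
have u1 : enorm u = 1 by rewrite enormZ ger0_norm ?invr_ge0 ?enorm_ge0 // mulVf ?gt_eqF.
have vE : v = enorm v *: u by rewrite scalerA mulfV ?gt_eqF // scale1r.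
have mZ := depends_on_measurable (@row_depends l u).
have ZK : (psi2_norm P (fun w => dot (row l (B w))^T u) <= K%:E)%E.
  by apply: le_trans (psiK l); apply: ereal_sup_ubound; exists u.
have vn : dot v v <= rho ^+ 2.
  apply: le_trans (spectral_norm_bound (invmx S) y) _.
  by rewrite -[leRHS]mulr1 ler_wpM2l ?sqr_ge0.
have th0 : 0 <= 2 * c0 * enorm v ^+ 2.
  by rewrite mulr_ge0 ?sqr_ge0 // mulr_ge0 // ltW.
have th : 2 * c0 * enorm v ^+ 2 * K ^+ 2 <= 16^-1.
  have cE : c0 * (1 + (K * rho) ^+ 2) = 32^-1.
    by rewrite /c0 invfM -mulrA mulVf ?mulr1 // gt_eqF // ltr_wpDr ?sqr_ge0.
  have := ler_wpM2l (mulr_ge0 (ltW c0_gt0) (sqr_ge0 K)) vn.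
  by rewrite sqr_enorm; move: cE; rewrite exprMn; have := c0_gt0; lra.
have eqZ w : 2 * c0 * enorm v ^+ 2 * dot (row l (B w))^T u ^+ 2 =
    2 * c0 * dot (row l (B w))^T v ^+ 2.
  have -> : dot (row l (B w))^T v = enorm v * dot (row l (B w))^T u.
    by rewrite -dotZr -vE.
  by ring.
by have := exponential_moment mZ th0 th ZK; under eq_integral do rewrite eqZ.
Qed.

Lemma row_deviation (y : 'cV[R]_r) (e : R) : dot y y <= 1 -> 0 < e <= 1 ->
  (P [set w | (r'%:R * e <= `|\sum_l dot (row l (B w))^T (invmx S *m y) ^+ 2
                              - r'%:R * dot y y|)%R]
     <= (2 * expR (- (r'%:R * (c0 ^+ 2 * e ^+ 2 / 16))))%:E)%E.
Proof.
move=> y1 /andP[e0 e1].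
have second l : (\int[P]_w (dot (row l (B w))^T (invmx S *m y) ^+ 2)%:E = (dot y y)%:E)%E.
  rewrite row_second_moment -SS -mulmxA -[X in X *m (S *m _)]sS -dot_mulmx.
  by rewrite mulKVmx.
apply: (@chernoff_sqr_sum _ _ _ P _ D Xe indX r' lab
  (fun l w => dot (row l (B w))^T (invmx S *m y)) _ (dot y y) c0 e c0_gt0 e0).
- by move=> l; exact: row_depends.
- have : c0 <= 1.
    rewrite invf_le1 ?mulr_gt0 ?ltr_wpDr ?sqr_ge0 //.
    by have := sqr_ge0 (K * rho); lra.
  by have := c0_gt0; nra.
- move=> l lam lamc; apply: sqr_mgf_bound => //.
  + exact: depends_on_measurable (@row_depends l _).
  + exact: row_exponential_moment.
Qed.

End Deviation.

End RandomizedMatrix.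

(** * From the net to the condition number *)

Lemma measure_bigsetU_le {disp : measure_display} {Omega : measurableType disp}
    {R : realType} (P : probability Omega R) (J : Type) (s : seq J)
    (Bad : J -> set Omega) (p : R) :
  (forall j, measurable (Bad j)) -> (forall j, (P (Bad j) <= p%:E)%E) ->
  measurable (\big[setU/set0]_(j <- s) Bad j) /\
  (P (\big[setU/set0]_(j <- s) Bad j) <= ((size s)%:R * p)%:E)%E.
Proof.
move=> mBad PBad; elim: s => [|j s [IH1 IH2]].
  by rewrite big_nil measure0 mul0r.
rewrite big_cons; split; first exact: measurableU.
apply: le_trans (measureU2 _ _ _) _ => //.
by rewrite /= -addn1 natrD mulrDl mul1r addrC EFinD leeD.
Qed.

Lemma pow64_le_expR {R : realType} (n : nat) : 64 ^+ n <= expR (6 * n%:R) :> R.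
Proof.
have h : (2 : R) <= expR 1 by apply: le_trans (expR_ge1Dx _); lra.
rewrite expRM_natr lerXn2r ?nnegrE ?expR_ge0 //.
rewrite -[6 : R]mulr1 expRM_natl.
have -> : (64 : R) = 2 ^+ 6 by ring.
by rewrite lerXn2r ?nnegrE ?expR_ge0.
Qed.

(** On the net, the form of [(B S^-1)^T (B S^-1) - N] is at most [N delta / 2],
    so everywhere it is at most [N delta]. Hence [B S^-1] stretches every
    vector by a factor between [sqrt (N (1 - delta))] and
    [sqrt (N (1 + delta))]. *)
Lemma kappa_of_net_deviation {R : realType} (N n : nat) (B : 'M[R]_(N, n))
    (S : 'M[R]_n) (delta : R) :
  (0 < n)%N -> (0 < N)%N -> S \in unitmx -> 0 <= delta < 1 ->
  (forall z, z \in @grid_net R n ->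
    `|\sum_l dot (row l B)^T (invmx S *m grid z) ^+ 2
      - N%:R * dot (grid z) (grid z)| <= N%:R * (delta / 2)) ->
  (kappa B <= ((1 + delta) / (1 - delta))%:E * kappa S)%E.
Proof.
move=> n0 N0 uS /andP[d0 d1] good.
have N0' : 0 < N%:R :> R by rewrite ltr0n.
have sN0 : 0 < Num.sqrt N%:R :> R by rewrite sqrtr_gt0.
have dB : 0 < 1 - delta by rewrite subr_gt0.
pose Q := (B *m invmx S)^T *m (B *m invmx S) - (N%:R)%:M.
have QE x : dot x (Q *m x) =
    \sum_l dot (row l B)^T (invmx S *m x) ^+ 2 - N%:R * dot x x.
  by rewrite mulmxBl dotBr dot_scalar_mx dot_gram -mulmxA dot_mulmx_rows.
have sQ : Q^T = Q by rewrite linearB /= gram_sym tr_scalar_mx.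
have bnd : forall x, `|dot x (Q *m x)| <= 2 * (N%:R * (delta / 2)) * dot x x.
  by apply: net_form_bound => // z zN; rewrite QE; exact: good.
have -> : (1 + delta) / (1 - delta) =
    Num.sqrt N%:R * (1 + delta) / (Num.sqrt N%:R * (1 - delta)).
  by rewrite -mulf_div mulfV ?gt_eqF // mul1r.
apply: kappa_sandwich => //; first exact: mulr_gt0.
  by rewrite mulr_ge0 ?addr_ge0 // ltW.
move=> x; have := bnd (S *m x).
rewrite QE mulKmx // -dot_mulmx_rows 2!exprMn sqr_sqrtr // ler_norml.
set D := dot (S *m x) (S *m x); set T := dot (B *m x) (B *m x).
have NDd : 0 <= N%:R * D * delta by rewrite !mulr_ge0 ?dot_ge0.
have h1 : 0 <= N%:R * D * delta * (1 - delta) by rewrite mulr_ge0 // ltW.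
have h2 : 0 <= N%:R * D * delta * delta by rewrite mulr_ge0.
by move=> /andP[h3 h4]; apply/andP; split; lra.
Qed.

(** The [64^r] net points cost a factor [exp (6 r)], which the part
    [C sqrt (r / N)] of the deviation pays for since [C^2 c >= 6]. *)
Lemma net_union_bound {R : realType} (r N : nat) (c0 t : R) :
  let a := 20 / c0 * Num.sqrt (r%:R / N%:R) in
  let b := t / Num.sqrt N%:R in
  (0 < N)%N -> 0 < c0 -> 0 <= t ->
  (#|@grid_net R r|%:R : R) *
    (2 * expR (- (N%:R * (c0 ^+ 2 * ((a + b) / 2) ^+ 2 / 16))))
  <= 2 * expR (- (c0 ^+ 2 / 64 * t ^+ 2)).
Proof.
move=> a b N0 c0p t0; have N0' : 0 < N%:R :> R by rewrite ltr0n.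
have a0 : 0 <= a by rewrite mulr_ge0 ?sqrtr_ge0 // divr_ge0 // ltW.
have b0 : 0 <= b by rewrite divr_ge0.
have card_le : (#|@grid_net R r|%:R : R) <= expR (6 * r%:R).
  by apply: le_trans (@card_grid_net R r) _; exact: pow64_le_expR.
apply: (le_trans (ler_wpM2r _ card_le)).
  by rewrite mulr_ge0 ?expR_ge0.
rewrite mulrCA -expRD ler_wpM2l // ler_expR.
have Na : N%:R * a ^+ 2 = (20 / c0) ^+ 2 * r%:R.
  rewrite exprMn sqr_sqrtr ?divr_ge0 //.
  by field; rewrite !gt_eqF.
have Nb : N%:R * b ^+ 2 = t ^+ 2.
  by rewrite expr_div_n sqr_sqrtr // mulrC divfK // gt_eqF.
have Nd : (20 / c0) ^+ 2 * r%:R + t ^+ 2 <= N%:R * (a + b) ^+ 2.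
  rewrite -Na -Nb -mulrDr ler_wpM2l ?(ltW N0') // sqrrD.
  by have := mulr_ge0 a0 b0; lra.
have := ler_wpM2l (sqr_ge0 c0) Nd.
have -> : c0 ^+ 2 * ((20 / c0) ^+ 2 * r%:R + t ^+ 2) = 400 * r%:R + c0 ^+ 2 * t ^+ 2.
  by field; rewrite gt_eqF.
by have : (0 : R) <= r%:R by []; lra.
Qed.

Theorem mainTheorem2 (R : realType) :
  exists C c : R -> R -> R,
    (forall K rho : R, 0 < C K rho /\ 0 < c K rho) /\
    forall (d : nat) (k : 'I_d) (r r' : nat) (M : 'I_d -> nat)
      (F : forall i : 'I_d, 'M[R]_(M i, r))
      (disp : measure_display) (Omega : measurableType disp)
      (P : probability Omega R)
      (X : forall i : 'I_d, 'I_(M i) -> 'I_r' -> {RV P >-> R})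
      (K : R) (S : 'M[R]_r),
    let B (w : Omega) : 'M[R]_(r', r) :=
      randomized_ALS_matrix k F (fun i => \matrix_(m, l) X i m l w) in
    let rho := spectral_norm (invmx S) in
    (2 <= d)%N -> (0 < r)%N -> (r < r')%N ->
    mutually_independent
      (fun e : {i : 'I_d & ('I_(M i) * 'I_r')%type} => tag e != k)
      (fun e => X (tag e) (tagged e).1 (tagged e).2) ->
    (forall i (m : 'I_(M i)) (l : 'I_r'), i != k ->
      signed_bernoulli (X i m l) \/ standard_gaussian (X i m l)) ->
    ALS_matrix k F \in unitmx ->
    is_psd_sqrt S (ALS_matrix k F) ->
    \big[maxe/-oo%E]_(l < r') psi2_norm_vec P (fun w => (row l (B w))^T)
      = K%:E ->
    forall t : R, 0 <= t ->
    let a := C K rho * Num.sqrt (r%:R / r'%:R) in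
    let b := t / Num.sqrt (r'%:R) in
    0 < 1 - a - b ->
    prob_at_least P (1 - 2 * expR (- (c K rho * t ^+ 2)))
      [set w | (kappa (B w) <= ((1 + a + b) / (1 - a - b))%:E * kappa S)%E].
Proof.
(* By [|S^-1 x| <= rho |x|], the sub-Gaussian norm of a row of [B S^-1] is at
   most [K rho], and [2 c0 (K rho)^2 <= 1/16] as exponential moments require.
   With [C = 20 / c0] and [c = c0^2 / 64] one has [C^2 c >= 6]. *)
pose c0 (K rho : R) := (32 * (1 + (K * rho) ^+ 2))^-1.
have c0_gt0 K rho : 0 < c0 K rho.
  by rewrite invr_gt0 mulr_gt0 // ltr_wpDr ?sqr_ge0.
exists (fun K rho => 20 / c0 K rho), (fun K rho => c0 K rho ^+ 2 / 64).
split; first by move=> K rho; split; rewrite divr_gt0 ?exprn_gt0.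
move=> d k r r' M F disp Omega P X K S B rho d2 r0 rr' indX momX uA [[sS pS] SS] maxK t t0 a b ab.
have c0p := c0_gt0 K rho.
have r'0 : (0 < r')%N by rewrite (ltn_trans r0).
have uS : S \in unitmx.
  by move: uA; rewrite -SS unitmx_mul => /andP[].
have psiK l : (psi2_norm_vec P (fun w => (row l (B w))^T) <= K%:E)%E.
  by rewrite -maxK; exact: (le_bigmax _ (fun l => psi2_norm_vec P (fun w => (row l (B w))^T))).
have a0 : 0 < a.
  apply: mulr_gt0; first exact: divr_gt0.
  by rewrite sqrtr_gt0 divr_gt0 // ltr0n.
have b0 : 0 <= b by rewrite divr_ge0.
pose delta := a + b; pose e := delta / 2.
have d0 : 0 < delta by rewrite ltr_wpDr.
have d1 : delta < 1 by rewrite -subr_gt0 /delta opprD addrA.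
have e01 : 0 < e <= 1 by apply/andP; rewrite /e; split; lra.
pose dev w (y : 'cV[R]_r) :=
  \sum_l dot (row l (B w))^T (invmx S *m y) ^+ 2 - r'%:R * dot y y.
pose Bad (z : {ffun 'I_r -> bool * 'I_(4 * r).+1}) :=
  if z \in @grid_net R r then [set w | r'%:R * e <= `|dev w (grid z)|] else set0.
have mBad z : measurable (Bad z).
  by rewrite /Bad; case: ifP => // _; exact: row_deviation_measurable.
pose p := 2 * expR (- (r'%:R * (c0 K rho ^+ 2 * e ^+ 2 / 16))).
have PBad z : (P (Bad z) <= p%:E)%E.
  rewrite /Bad; case: ifPn => [zN|_]; last by rewrite measure0 lee_fin mulr_ge0 ?expR_ge0.
  have z1 : dot (grid z) (grid z) <= 1 :> R by move: zN; rewrite inE => /andP[].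
  exact: (row_deviation indX momX uS sS SS psiK z1 e01).
pose U := \big[setU/set0]_(z <- enum (@grid_net R r)) Bad z.
have [mU PU] := measure_bigsetU_le (enum (@grid_net R r)) mBad PBad.
exists (~` U); split; first exact: measurableC.
- move=> w Uw /=.
  have -> : 1 + a + b = 1 + delta by rewrite /delta addrA.
  have -> : 1 - a - b = 1 - delta by rewrite /delta opprD addrA.
  apply: kappa_of_net_deviation => //; first by rewrite d1 ltW.
  move=> z zN; rewrite leNgt; apply/negP => bad; apply: Uw.
  rewrite /U -bigcup_seq; exists z; first by rewrite /= mem_enum.
  by rewrite /Bad zN /= /dev ltW.
- rewrite probability_setC // EFinB leeB //.
  apply: le_trans PU _; rewrite lee_fin -cardE.
  exact: net_union_bound.
Qed.
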